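(* Let $\alpha\ge1$, and let $m_\alpha\in[-3,-2]$ be the unique non-zero real solution of \[ (m+1)^{2\alpha}(m+1)-\bigl((2\alpha+1)m+1\bigr)=0. \] Let $q_0=(x_0,y_0)\in\mathbb{G}_\alpha$ with $x_0=0$ and let $q\in\mathbb{G}_\alpha$ with $q\notin\mathrm{Cut}(q_0)$. Then the inequality \[ \beta_t(q_0,q)\ge t^N \] holds for all $t\in[0,1]$ and every $N\ge 2\left[\dfrac{(\alpha+1)m_\alpha+1}{m_\alpha+1}\right]$.
   Context: Convention: for real $a$, $a^{2\alpha}$ means $(a^2)^\alpha=|a|^{2\alpha}$ (and similarly for $a^{2(\alpha-1)}$). The $\alpha$-Grushin plane $\mathbb{G}_\alpha$ ($\alpha\ge1$) is $\mathbb{R}^2$ with the sub-Riemannian structure generated by the vector fields $X=\partial_x$ and $Y_\alpha=|x|^\alpha\partial_y$. A curve $\gamma=(x,y):[0,T]\to\mathbb{R}^2$ is horizontal if it is Lipschitz and there are $L^2$ functions $a,b$ with $\dot\gamma=aX(\gamma)+bY_\alpha(\gamma)$ almost everywhere; its length is $\int_0^T\|\dot\gamma\|\,dt$, where $\|w\|$ is the minimum of $\sqrt{a^2+b^2}$ over all $(a,b)$ with $w=aX+bY_\alpha$ at the point. The distance $\mathrm{d}_\alpha$ between two points is the infimum of lengths of horizontal curves joining them. $\mathbb{G}_\alpha$ is equipped with $\mathrm{d}_\alpha$ and the Lebesgue measure $\mathcal{L}^2$. A curve is minimising if its length equals the distance between its endpoints. The Hamiltonian is $H(x,y,u,v)=\frac12(u^2+v^2x^{2\alpha})$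 on $T^*\mathbb{R}^2$. A normal extremal is a solution of Hamilton's equations $\dot x=u$, $\dot y=v\,x^{2\alpha}$, $\dot u=-\alpha v^2x^{2(\alpha-1)}x$, $\dot v=0$. Its projection $(x(t),y(t))$ is called a geodesic. Every constant speed minimising curve is a geodesic in this sense. For a geodesic $\gamma:[0,\infty)\to\mathbb{G}_\alpha$ the cut time is $t_{\mathrm{cut}}[\gamma]=\sup\{t>0:\gamma|_{[0,t]}\text{ is minimising}\}$; if it is finite, $\gamma(t_{\mathrm{cut}}[\gamma])$ is the cut point of $\gamma(0)$ along $\gamma$. $\mathrm{Cut}(q_0)$ is the set of all cut points of geodesics starting at $q_0$. Distortion coefficient: for $p,p'\in\mathbb{G}_\alpha$ and $t\in[0,1]$, \[\beta_t(p,p')=\limsup_{r\to0^+}\frac{\mathcal{L}^2(Z_t(p,B_r(p')))}{\mathcal{L}^2(B_r(p'))},\] where $B_r(p')$ is the $\mathrm{d}_\alpha$-ball and $Z_t(p,B)$ is the set of points $\gamma(t)$ for $\gamma:[0,1]\to\mathbb{G}_\alpha$ a constant speed minimising geodesic with $\gamma(0)=p$, $\gamma(1)\in B$ (outer measure is used if the set is not measurable). *)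

(* Defs.v *)
From mathcomp Require Export all_boot all_order all_algebra.
From mathcomp Require Export all_classical all_reals all_analysis.
Export Order.TTheory GRing.Theory Num.Theory.
Export numFieldNormedType.Exports.

Set Implicit Arguments.
Unset Strict Implicit.
Unset Printing Implicit Defensive.

Local Open Scope classical_set_scope.
Local Open Scope ring_scope.

(* Curves are total functions [R -> R * R] of which
   only the values on the relevant time set matter.  Real powers of a possibly
   negative number are taken of its absolute value: [x^(2 alpha)] is
   [`|x| `^ (2 * alpha)].  Since [0 `^ 0 = 1], [x^(2 (alpha - 1)) = 1] when
   [alpha = 1]. *)

Section Grushin.
Variables (R : realType) (alpha : R).

Local Notation mu := (@lebesgue_measure R).

Definition grushinX (p : R * R) : R * R := (1, 0).

Definition grushinY (p : R * R) : R * R := (0, `|p.1| `^ alpha).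

(* +oo when [w] is not in the span of the two fields at [p]; otherwise the
   infimum is attained. *)
Definition grushin_norm (p w : R * R) : \bar R :=
  ereal_inf [set (Num.sqrt (ab.1 ^+ 2 + ab.2 ^+ 2))%:E
            | ab in [set ab : R * R |
                     w = ab.1 *: grushinX p + ab.2 *: grushinY p]].

Definition square_integrable (D : set R) (f : R -> R) : Prop :=
  measurable_fun D f /\ mu.-integrable D (fun t => (f t ^+ 2)%:E).

(* The end points of [0, T], where [is_derive] would look outside the interval,
   form a null set. *)
Definition horizontal (T : R) (gamma : R -> R * R) : Prop :=
  [lipschitz gamma t | t in `[0, T]] /\
  exists a b : R -> R,
    [/\ square_integrable `[0, T] a,
        square_integrable `[0, T] b &
        {ae mu, forall t, t \in `[0, T] ->
           is_derive t (1 : R) gamma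
             (a t *: grushinX (gamma t) + b t *: grushinY (gamma t))}].

Definition speed (gamma : R -> R * R) (t : R) : \bar R :=
  grushin_norm (gamma t) ('D_1 gamma t).

Definition grushin_length (T : R) (gamma : R -> R * R) : \bar R :=
  (\int[mu]_(t in `[0%R, T]) speed gamma t)%E.

Definition grushin_dist (p q : R * R) : \bar R :=
  ereal_inf [set l | exists (T : R) (gamma : R -> R * R),
    [/\ 0 < T, horizontal T gamma, gamma 0 = p, gamma T = q &
        l = grushin_length T gamma]].

Definition grushin_ball (p : R * R) (r : R) : set (R * R) :=
  [set q | (grushin_dist p q < r%:E)%E].

Definition minimising (T : R) (gamma : R -> R * R) : Prop :=
  horizontal T gamma /\
  grushin_length T gamma = grushin_dist (gamma 0) (gamma T).

Definition constant_speed (T : R) (gamma : R -> R * R) : Prop :=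
  exists c : R, {ae mu, forall t, t \in `[0, T] -> speed gamma t = c%:E}.

(* Hamilton's equations for H(x,y,u,v) = (u^2 + v^2 x^(2 alpha)) / 2. *)
Definition hamilton_equations (x y u v : R -> R) (t : R) : Prop :=
  [/\ is_derive t (1 : R) x (u t),
      is_derive t (1 : R) y (v t * `|x t| `^ (2 * alpha)),
      is_derive t (1 : R) u
        (- (alpha * v t ^+ 2 * `|x t| `^ (2 * (alpha - 1)) * x t)) &
      is_derive t (1 : R) v 0].

(* Continuity on [I] together with the equations in the interior is equivalent,
   the right-hand sides being continuous, to the equations on all of [I] with
   one-sided derivatives at the end points. *)
Definition normal_extremal (I : set R) (x y u v : R -> R) : Prop :=
  [/\ {within I, continuous x}, {within I, continuous y},
      {within I, continuous u}, {within I, continuous v} &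
      forall t, interior I t -> hamilton_equations x y u v t].

Definition geodesic (I : set R) (gamma : R -> R * R) : Prop :=
  exists u v : R -> R,
    normal_extremal I (fun t => (gamma t).1) (fun t => (gamma t).2) u v.

Definition cut_time (gamma : R -> R * R) : \bar R :=
  ereal_sup [set t%:E | t in [set t : R | 0 < t /\ minimising t gamma]].

Definition Cut (q0 : R * R) : set (R * R) :=
  [set q | exists (gamma : R -> R * R) (c : R),
     [/\ geodesic `[0, +oo[ gamma, gamma 0 = q0,
         cut_time gamma = c%:E & q = gamma c]].

(* Lebesgue outer measure on the plane; it agrees with Lebesgue measure on
   measurable sets, in particular on balls. *)
Definition leb2 (A : set (R * R)) : \bar R :=
  mu_ext (mu \x mu)%E A.

Definition intermediate (t : R) (p : R * R) (B : set (R * R)) : set (R * R) :=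
  [set z | exists gamma : R -> R * R,
     [/\ geodesic `[0, 1] gamma,
         minimising 1 gamma /\ constant_speed 1 gamma,
         gamma 0 = p, B (gamma 1) & z = gamma t]].

(* For small r > 0 the denominator is positive and finite, so the conventions
   for division in [\bar R] play no role. *)
Definition distortion (t : R) (p p' : R * R) : \bar R :=
  limf_esup (fun r : R =>
      leb2 (intermediate t p (grushin_ball p' r)) / leb2 (grushin_ball p' r))%E
    (0 : R)^'+.

Definition m_alpha_equation (m : R) : Prop :=
  `|m + 1| `^ (2 * alpha) * (m + 1) - ((2 * alpha + 1) * m + 1) = 0.

Definition is_m_alpha (m : R) : Prop :=
  [/\ -3 <= m <= -2, m != 0, m_alpha_equation m &
      forall m' : R, m' != 0 -> m_alpha_equation m' -> m' = m].

End Grushin.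

(* Main.v *)
Require Import Defs.
From mathcomp Require Import measurable_realfun ring lra.

(* A minimising geodesic issued from the singular axis at q0 = (0, y0) is
   [(r S(w t), y0 +- r^(al+1) Y(w t))] with 0 < w < P, where S, C and Y are
   generalized trigonometric functions ([S' = C], [S^(2 al) + C^2 = 1],
   [Y' = S^(2 al)]).  In the coordinates [x] and [q = |y - y0| / |x|^(al+1)] the
   map sending the end point to the point at time t is
   [(x, q) |-> (shrink q * x, slide q)].  Its Jacobian is bounded below because
   [g = S - x C] satisfies [x g' <= (2 al + 1) g], hence
   [g (t x) >= t^(2 al + 1) g x].  This gives
   [leb2 (intermediate t q0 B) >= t^(2 al + 2) leb2 B] for every set B, so that
   the exponent [2 al + 2] suffices, and it is at most the exponent of the
   statement.  Minimality of these curves comes from the function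
   [candidate x y = x F (y / x^(al+1))], which solves the eikonal equation and
   therefore bounds lengths from below. *)

Set Implicit Arguments.
Unset Strict Implicit.
Unset Printing Implicit Defensive.

Local Open Scope classical_set_scope.
Local Open Scope ring_scope.

(** * Real powers and the exponent *)

(** The area element is |x|^(al+1) dx dq in the coordinates (x, q), so the Jacobian of the
    contraction is shrink^(al+2) * slide'. All powers of [S] cancel in it and t g(t phi) / g(phi)
    remains: one factor t comes from the argument t phi and 2 al + 1 further ones from g, which
    behaves like a multiple of x^(2 al + 1) at 0. A lower bound on the intermediate set requires
    only one minimiser to each end point off the lines x = 0 and y = y0, and these lines are null.
    Since [leb2] is an outer measure, the estimate is run backwards: any measurable set M containing
    the intermediate set is pulled back by the contraction, the preimage contains B up to the two
    lines, and its measure is at most t^(-(2 al + 2)) times that of M. Lengths raise a similar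
    obstacle: [speed] is compared with other functions without being shown measurable, so integrals
    are treated as suprema over simple functions. *)

Lemma is_derive_continuous (R : realType) (f : R -> R) (x d : R) :
  is_derive x 1 f d -> {for x, continuous f}.
Proof. by move=> [df _]; apply/differentiable_continuous/derivable1_diffP. Qed.

Section powR.
Variable R : realType.
Implicit Types b c w x : R.

(** Young's inequality with second factor 1: w <= w^c / c + (1 - 1/c). *)
Lemma bernoulli_powR c w : 1 <= c -> 0 <= w -> 1 + c * (w - 1) <= w `^ c.
Proof.
rewrite le_eqVlt => /predU1P[<- w0|c1 w0]; first by rewrite powRr1//; lra.
have c0 : 0 < c by lra.
have q0 : 0 < 1 - c^-1 by rewrite subr_gt0 invf_lt1.
have := @conjugate_powR R w 1 c (1 - c^-1)^-1 w0 ler01 c0.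
rewrite invr_gt0 invrK => /(_ q0); rewrite (addrC c^-1) subrK => /(_ erefl).
rewrite mulr1 powR1 mul1r -(ler_pM2l c0) mulrDr mulrCA mulfV ?gt_eqF// mulr1.
by rewrite mulrBr mulfV ?gt_eqF//; lra.
Qed.

(** Squaring the inequality for the exponent c / 2 gains the term (c^2 / 4) (w - 1)^2. When the
    affine bound to be squared is negative, 1 + c (w - 1) is negative too and cannot be a power. *)
Lemma bernoulli_powR_eq c w : 2 <= c -> 0 <= w ->
  w `^ c = 1 + c * (w - 1) -> w = 1.
Proof.
move=> c2 w0 e; have [//|w1] := eqVneq w 1.
have := @bernoulli_powR (c / 2) w ltac:(lra) w0.
have := powR_ge0 w (c / 2).
have : w `^ c = w `^ (c / 2) ^+ 2.
  by rewrite expr2 -powRD -?splitr//; apply/implyP => /eqP; lra.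
have d0 : 0 < (w - 1) ^+ 2 by rewrite exprn_even_gt0//= subr_eq0.
rewrite e; set u := w `^ (c / 2) => h1 h2 h3.
have [k|k] := lerP 0 (1 + c / 2 * (w - 1)).
  have : (1 + c / 2 * (w - 1)) ^+ 2 <= u ^+ 2 by rewrite ler_sqr ?nnegrE.
  have c0 : 0 < c by lra.
  by rewrite -h1; have := mulr_gt0 (mulr_gt0 c0 c0) d0; nra.
by have := sqr_ge0 u; rewrite -h1; nra.
Qed.

Lemma continuous_powR c x : 0 < x -> {for x, continuous (fun y : R => y `^ c)}.
Proof. by move=> x0; exact: is_derive_continuous (@is_derive1_powR R c x x0). Qed.

(* This and [powR_root_unique] concern [w = - (m + 1)] for the solution
   [m < -1] of the equation defining m_alpha. *)
Lemma powR_root_exists c : 1 <= c ->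
  exists2 w, 1 <= w <= 2 & w `^ (2 * c) * w = (2 * c + 1) * w + 2 * c.
Proof.
move=> c1; pose p w : R := w `^ (2 * c) * w - ((2 * c + 1) * w + 2 * c).
have [||w w12 pw0] := @IVT R p 1 2 0 ltac:(lra).
- apply: continuous_in_subspaceT => x; rewrite inE/= in_itv/= => /andP[x1 _].
  apply: cvgB; first by apply: cvgM => //; apply: continuous_powR; lra.
  by apply: cvgD; [apply: cvgM => //; exact: cvg_cst|exact: cvg_cst].
- rewrite /p powR1 ge_min le_max; apply/andP; split; apply/orP; [left; lra|right].
  (* At the right end 2 * 4^c >= 2 (1 + 3 c) = (2 c + 1) * 2 + 2 c. *)
  rewrite powRrM powR_mulrn//; have := @bernoulli_powR c (2 ^+ 2) c1 ltac:(by []).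
  rewrite expr2; lra.
- by exists w; rewrite ?(itvP w12)//; apply/eqP; rewrite -subr_eq0; apply/eqP.
Qed.

Lemma powR_root_unique c w w' : 1 <= c -> 0 < w -> w < w' ->
  w `^ (2 * c) * w = (2 * c + 1) * w + 2 * c ->
  w' `^ (2 * c) * w' <> (2 * c + 1) * w' + 2 * c.
Proof.
move=> c1 w0 ww' e e'; pose q := w' / w.
have w'E : w' = w * q by rewrite /q mulrC divfK// gt_eqF.
have q1 : 1 < q by rewrite /q ltr_pdivlMr// mul1r.
(* From w to w' = w q the left side E = (2 c + 1) w + 2 c is multiplied by q^(2c+1), hence grows by
   at least (2 c + 1) E (q - 1), whereas the right side grows by only (2 c + 1) w (q - 1). *)
have := @bernoulli_powR (2 * c + 1) q ltac:(lra) ltac:(lra).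
have q0 : 0 < q by lra.
rewrite powRD ?powRr1; [|lra|by rewrite (gt_eqF q0) implybT].
move: e'; rewrite w'E powRM; [|lra|lra].
rewrite mulrACA e => e'.
rewrite -(@ler_pM2l _ ((2 * c + 1) * w + 2 * c)); last nra.
rewrite e'; have : 0 < c * (q - 1) by rewrite mulr_gt0; lra.
have : 0 < (c * (q - 1)) * w by rewrite !mulr_gt0; lra.
nra.
Qed.

End powR.

(** With w = - (m + 1) the exponent of the theorem equals 2 c + 2 + 2 c / w. Uniqueness splits at m'
    = -1: above it the equation is the equality case of Bernoulli's inequality for the exponent 2 c
    + 1, which forces m' = 0; below it - (m' + 1) is a root of the equation for w. *)
Lemma is_m_alpha_exists (R : realType) (c : R) : 1 <= c ->
  exists2 m, is_m_alpha c m & 2 * c + 2 <= 2 * (((c + 1) * m + 1) / (m + 1)).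
Proof.
move=> c1; have [w /andP[w1 w2] e] := powR_root_exists c1.
exists (- w - 1); last first.
  have -> : (c + 1) * (- w - 1) + 1 = - ((c + 1) * w + c) by ring.
  rewrite subrK invrN mulrNN.
  have : c + 1 <= ((c + 1) * w + c) / w by rewrite ler_pdivlMr; nra.
  by lra.
split.
- by apply/andP; split; lra.
- by apply/eqP; lra.
- rewrite /m_alpha_equation subrK normrN ger0_norm; last lra.
  by rewrite mulrN e; ring.
- move=> m' m'0; rewrite /m_alpha_equation.
  have [m1|m1] := lerP 0 (m' + 1).
    rewrite ger0_norm//= -{2}(powRr1 m1) -powRD => [/eqP|]; last first.
      by apply/implyP => /eqP; lra.
    rewrite subr_eq0 => /eqP h; move: m'0; rewrite -(addrK 1 m').
    by rewrite (@bernoulli_powR_eq _ (2 * c + 1) (m' + 1)) ?subrr ?eqxx; lra.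
  rewrite ltr0_norm// => h.
  have e' : (- (m' + 1)) `^ (2 * c) * (- (m' + 1)) =
      (2 * c + 1) * (- (m' + 1)) + 2 * c by lra.
  have w0 : 0 < w by lra.
  have v0 : 0 < - (m' + 1) by lra.
  have [ww|ww|] := ltgtP w (- (m' + 1)); last by lra.
  - by have := powR_root_unique c1 w0 ww e e'.
  - by have := powR_root_unique c1 v0 ww e' e.
Qed.

(** * Calculus *)

Lemma derive_ge0_le (R : realType) (f df : R -> R) (a b : R) : a <= b ->
  {within `[a, b], continuous f} ->
  (forall x, a < x < b -> is_derive x 1 f (df x)) ->
  (forall x, a < x < b -> 0 <= df x) -> f a <= f b.
Proof.
rewrite le_eqVlt => /predU1P[->//|ab] cf df_ df0.
have H x : x \in `]a, b[ -> is_derive x 1 f (df x) by rewrite in_itv; exact: df_.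
have [c] := MVT ab H cf.
rewrite in_itv/= => cab e; rewrite -subr_ge0 e mulr_ge0 ?df0//.
by rewrite subr_ge0 ltW.
Qed.

Lemma derive_gt0_lt (R : realType) (f df : R -> R) (a b : R) : a < b ->
  {within `[a, b], continuous f} ->
  (forall x, a < x < b -> is_derive x 1 f (df x)) ->
  (forall x, a < x < b -> 0 < df x) -> f a < f b.
Proof.
move=> ab cf df_ df0.
have H x : x \in `]a, b[ -> is_derive x 1 f (df x) by rewrite in_itv; exact: df_.
have [c] := MVT ab H cf.
by rewrite in_itv/= => cab e; rewrite -subr_gt0 e mulr_gt0 ?df0// subr_gt0.
Qed.

Lemma within_continuous_derive (R : realType) (f df : R -> R) (a b x y : R) :
  a < x -> y < b -> (forall x, a < x < b -> is_derive x 1 f (df x)) ->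
  {within `[x, y], continuous f}.
Proof.
move=> ax yb df_; apply: continuous_in_subspaceT => z; rewrite inE/= in_itv/=.
move=> /andP[xz zy]; apply: is_derive_continuous (df_ z _).
by rewrite (lt_le_trans ax xz) (le_lt_trans zy yb).
Qed.

(** Stated on an open interval because the derivative may blow up at the ends, as that of [tau] does
    for al > 1. The inverse takes the default value [a] off the image of ]a, b[. *)
Lemma derive_inverse_oo (R : realType) (f df : R -> R) (a b : R) :
  (forall x, a < x < b -> is_derive x 1 f (df x)) ->
  (forall x, a < x < b -> 0 < df x) ->
  exists h : R -> R, forall x, a < x < b ->
    h (f x) = x /\ is_derive (f x) 1 h (df x)^-1.
Proof.
move=> df_ df0.
have fmono x y : a < x -> x < y -> y < b -> f x < f y.
  move=> ax xy yb; apply: (derive_gt0_lt xy) (within_continuous_derive ax yb df_) _ _.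
    by move=> z /andP[xz zy]; apply: df_; rewrite (lt_trans ax xz) (lt_trans zy yb).
  by move=> z /andP[xz zy]; apply: df0; rewrite (lt_trans ax xz) (lt_trans zy yb).
have finj x y : a < x < b -> a < y < b -> f x = f y -> x = y.
  move=> /andP[ax xb] /andP[ay yb] e.
  have [xy|yx|//] := ltgtP x y.
    by have := fmono _ _ ax xy yb; rewrite e ltxx.
  by have := fmono _ _ ay yx xb; rewrite e ltxx.
exists (fun y => xget a [set x | a < x < b /\ f x = y]).
set h := fun y => _.
have hK x : a < x < b -> h (f x) = x.
  move=> xab; rewrite /h; case: xgetP => [z _ [zab /finj]|/(_ x)]; first exact.
  by move=> /not_andP[].
have nearab x : a < x < b -> \forall z \near x, a < z < b.
  move=> /andP[ax xb]; near=> z; apply/andP; split; near: z.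
  - exact: lt_nbhsr.
  - exact: lt_nbhsl.
move=> x xab; split; first exact: hK.
apply: is_derive_inverse (df_ _ xab) _; last by rewrite gt_eqF// df0.
- by near=> z; apply: hK; near: z; exact: nearab.
- near=> z; apply: is_derive_continuous (df_ z _); near: z; exact: nearab.
Unshelve. all: by end_near. Qed.

(** The norm makes the power continuous on the whole line, so composites with [sin] or [S] stay
    continuous at the ends, where these functions vanish. *)
Lemma continuous_norm_powR (R : realType) (c : R) : 0 < c ->
  continuous (fun x : R => `|x| `^ c).
Proof.
move=> c0 x; have [->|x0] := eqVneq x 0; last first.
  have h : {for `|x|, continuous (fun y : R => y `^ c)}.
    by apply: continuous_powR; rewrite normr_gt0.
  by apply: continuous_comp h; exact: norm_continuous.
apply/cvgrPdist_lt => e e0; rewrite normr0 powR0 ?gt_eqF//.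
near=> z; rewrite sub0r normrN ger0_norm ?powR_ge0//.
have -> : e = (e `^ c^-1) `^ c by rewrite -powRrM mulVf ?gt_eqF// powRr1 ?ltW.
apply: gt0_ltr_powR; rewrite ?nnegrE ?powR_ge0//.
by near: z; apply: (@nbhs0_lt _ R^o); rewrite powR_gt0.
Unshelve. all: by end_near. Qed.

Lemma antiderivative_exists (R : realType) (f : R -> R) (a b : R) :
  continuous f -> a <= b ->
  exists F : R -> R, [/\ F a = 0, {within `[a, b], continuous F} &
    forall x, a < x < b -> is_derive x 1 F (f x)].
Proof.
move=> cf ab; pose mu := @lebesgue_measure R.
have fi : mu.-integrable `[a, b] (EFin \o f).
  apply: continuous_compact_integrable; first exact: segment_compact.
  exact: continuous_subspaceT.
exists (fun x => \int[mu]_(t in `[a, x]) f t)%R; split.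
- by rewrite set_itv1 Rintegral_set1.
- exact: parameterized_integral_continuous.
- move=> x /andP[ax xb].
  have [||d e] := @continuous_FTC1 _ f (BLeft a) x b xb fi.
  - by have : a <= x := ltW ax.
  - exact: cf.
  by apply: DeriveDef => //; rewrite -derive1E.
Qed.

Section derivation_rules.
Variable R : realType.
Implicit Types (f g : R -> R) (x a b c : R).

Lemma is_derive_comp f g x a b : is_derive (g x) 1 f a -> is_derive x 1 g b ->
  is_derive x 1 (fun y => f (g y)) (a * b).
Proof. exact: is_derive1_comp. Qed.

Lemma is_derive_mul f g x a b : is_derive x 1 f a -> is_derive x 1 g b ->
  is_derive x 1 (fun y => f y * g y) (f x * b + g x * a).
Proof. by move=> df dg; exact: is_deriveM. Qed.

Lemma is_derive_add f g x a b : is_derive x 1 f a -> is_derive x 1 g b ->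
  is_derive x 1 (fun y => f y + g y) (a + b).
Proof. by move=> df dg; exact: is_deriveD. Qed.

Lemma is_derive_sub f g x a b : is_derive x 1 f a -> is_derive x 1 g b ->
  is_derive x 1 (fun y => f y - g y) (a - b).
Proof. by move=> df dg; exact: is_deriveB. Qed.

Lemma is_derive_cmul f x a c : is_derive x 1 f a ->
  is_derive x 1 (fun y => c * f y) (c * a).
Proof. by move=> df; exact: is_deriveZ. Qed.

Lemma is_derive_powR f x a c : 0 < f x -> is_derive x 1 f a ->
  is_derive x 1 (fun y => f y `^ c) (c * f x `^ (c - 1) * a).
Proof.
move=> fx0 df.
exact: (@is_derive_comp (fun y => y `^ c) f x _ a (is_derive1_powR c fx0) df).
Qed.

Lemma is_derive_div f g x a b : g x != 0 ->
  is_derive x 1 f a -> is_derive x 1 g b ->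
  is_derive x 1 (fun y => f y / g y) ((a * g x - f x * b) / g x ^+ 2).
Proof.
move=> gx0 df dg; have := is_derive_mul df (is_deriveV gx0 dg).
move/is_derive_eq; apply; rewrite /GRing.scale/=.
have e : (g x)^-1 = g x / g x ^+ 2 by rewrite expr2 invfM mulrA mulfV// mul1r.
by rewrite e; ring.
Qed.

Lemma is_derive_scale_arg f x a c : is_derive (c * x) 1 f a ->
  is_derive x 1 (fun y => f (c * y)) (c * a).
Proof.
move=> df; rewrite mulrC -{2}[c]mulr1; exact: is_derive_comp df (is_derive_cmul c (is_derive_id x 1)).
Qed.

End derivation_rules.

(** * Generalized trigonometric functions *)

(* [(S, C, Y)] is, up to dilations, the geodesic issued from the origin:
   [x = S], [u = C], [y = Y]; it returns to the singular axis at time [P]. *)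
Record gentrig (R : realType) (al P : R) (S C Y : R -> R) : Prop := GenTrig {
  gentrig_S0 : S 0 = 0 ;
  gentrig_C0 : C 0 = 1 ;
  gentrig_Scont : {within `[0, P], continuous S} ;
  gentrig_Ccont : {within `[0, P], continuous C} ;
  gentrig_S_gt0 : forall x, 0 < x < P -> 0 < S x ;
  gentrig_dS : forall x, 0 < x < P -> is_derive x 1 S (C x) ;
  gentrig_dC : forall x, 0 < x < P ->
    is_derive x 1 C (- (al * S x `^ (2 * al - 1))) ;
  gentrig_S2C2 : forall x, 0 <= x <= P -> S x `^ al ^+ 2 + C x ^+ 2 = 1 ;
  gentrig_Y : forall x, (al + 1) * Y x = x - S x * C x ;
  gentrig_surj : forall q, 0 < q ->
    exists2 x, 0 < x < P & Y x = q * S x `^ (al + 1) }.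

(* In the angular parameter th with S^al = sin th and C = cos th, the time is
   [S C + (al + 1) Y], where [Y] has the continuous derivative
   [sin^(1 + 1/al) / al]; this avoids the improper integral
   [\int al^-1 sin^(1/al - 1)]. *)
Lemma gentrig_exists (R : realType) (al : R) : 1 <= al ->
  exists P S C Y, @gentrig R al P S C Y.
Proof.
move=> al1; have al0 : 0 < al by lra.
pose p := al^-1; have p0 : 0 < p by rewrite invr_gt0.
have alp : al * p = 1 by rewrite mulfV// gt_eqF.
have cdY : continuous (fun t : R => p * `|sin t| `^ (1 + p)).
  move=> x; apply: cvgM; first exact: cvg_cst.
  apply: (@continuous_comp _ _ _ sin (fun y : R => `|y| `^ (1 + p))).
    exact: continuous_sin.
  by apply: continuous_norm_powR; rewrite addr_gt0.
have [Yt [Yt0 cYt dYt]] := antiderivative_exists cdY (pi_ge0 R).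
have pi0 := pi_gt0 R.
pose St (t : R) : R := `|sin t| `^ p.
have cSt : continuous St.
  move=> x; apply: (@continuous_comp _ _ _ sin (fun y : R => `|y| `^ p)).
    exact: continuous_sin.
  exact: continuous_norm_powR.
have s0 (x : R) : 0 < x < pi -> 0 < sin x by exact: sin_gt0_pi.
have nears (x : R) : 0 < x < pi -> \forall z \near x, `|sin z| = sin z.
  move=> x0; near=> z; rewrite gtr0_norm//; near: z.
  by apply: cvgr_gt (s0 _ x0); exact: continuous_sin.
have dSt x : 0 < x < pi -> is_derive x 1 St (p * sin x `^ (p - 1) * cos x).
  move=> x0; apply: (@near_eq_is_derive _ _ _ (fun z => sin z `^ p)).
    by near=> z; rewrite /St; congr (_ `^ _); apply/esym; near: z; exact: nears.
  exact: (@is_derive1_comp _ (fun y : R => y `^ p) sin _ _ _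
           (is_derive1_powR p (s0 _ x0)) (is_derive_sin x)).
pose tau t := St t * cos t + (al + 1) * Yt t.
have ctau : {within `[0, pi], continuous tau}.
  move=> x; apply: cvgD.
    apply: (@continuous_subspaceT _ _ _ (fun t => St t * cos t)) => z.
    by apply: cvgM; [exact: cSt|exact: continuous_cos].
  by apply: cvgM; [exact: cvg_cst|exact: cYt].
(* This is the derivative of [St] divided by cos, as S' = C requires; the terms in sin^2 collapse by
   al p = 1. *)
have dtau x : 0 < x < pi -> is_derive x 1 tau (p * sin x `^ (p - 1)).
  move=> x0; have := s0 _ x0 => sx.
  have h : is_derive x 1 tau (St x *: (- sin x) + cos x *: (p * sin x `^ (p - 1) * cos x)
      + (al + 1) *: (p * `|sin x| `^ (1 + p))).
    have dS := dSt _ x0; have dY := dYt _ x0.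
    exact: is_deriveD.
  apply: is_derive_eq h _.
  rewrite /St gtr0_norm// /GRing.scale/=.
  have -> : sin x `^ (1 + p) = sin x ^+ 2 * sin x `^ (p - 1).
    rewrite -(powR_mulrn 2 (ltW sx)) -powRD; last by rewrite (gt_eqF sx) implybT.
    by congr (_ `^ _); ring.
  have -> : sin x `^ p = sin x * sin x `^ (p - 1) by rewrite mulr_powRB1// ltW.
  transitivity (sin x `^ (p - 1) * (p * (cos x ^+ 2 + sin x ^+ 2) + (al * p - 1) * sin x ^+ 2)).
    by ring.
  by rewrite cos2Dsin2 alp; ring.
have tau0 : tau 0 = 0.
  by rewrite /tau /St sin0 normr0 powR0 ?gt_eqF// Yt0; ring.
have dtau0 x : 0 < x < pi -> 0 < p * sin x `^ (p - 1).
  by move=> x0; rewrite mulr_gt0// powR_gt0// s0.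
have taumono x y : 0 <= x -> x < y -> y <= pi -> tau x < tau y.
  move=> x0 xy ypi; apply: (@derive_gt0_lt _ tau (fun x => p * sin x `^ (p - 1)) _ _ xy).
  - apply: continuous_subspaceW ctau => z/=; rewrite !in_itv/= => /andP[xz zy].
    by rewrite (le_trans x0 xz) (le_trans zy ypi).
  - move=> z /andP[xz zy]; apply: dtau; rewrite (le_lt_trans x0 xz)/=.
    exact: lt_le_trans zy ypi.
  - move=> z /andP[xz zy]; apply: dtau0; rewrite (le_lt_trans x0 xz)/=.
    exact: lt_le_trans zy ypi.
have tauinj x y : 0 <= x <= pi -> 0 <= y <= pi -> tau x = tau y -> x = y.
  move=> /andP[ax xb] /andP[ay yb] e.
  have [xy|yx|//] := ltgtP x y.
    by have := taumono _ _ ax xy yb; rewrite e ltxx.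
  by have := taumono _ _ ay yx xb; rewrite e ltxx.
pose P := tau pi.
have P0 : 0 < P by rewrite -tau0; exact: taumono.
have [Th dTh] := derive_inverse_oo dtau dtau0.
(* The inverse of [tau] on ]0, P[, continued by its end values so as to be a left inverse on the
   closed segment; continuity on [0, P] then follows from that of [tau]. *)
pose Theta (x : R) : R := if x <= 0 then 0 else if P <= x then pi else Th x.
have ThK x : 0 <= x <= pi -> Theta (tau x) = x.
  rewrite /Theta => /andP[]; rewrite le_eqVlt => /predU1P[<- _|x0].
    by rewrite tau0 lexx.
  have := taumono 0 x (lexx 0) x0; rewrite tau0 => h.
  rewrite le_eqVlt => /predU1P[xpi|xpi].
    by rewrite xpi -/P lt_geF// lexx.
  have -> : (tau x <= 0) = false by rewrite lt_geF// h// ltW.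
  have -> : (P <= tau x) = false by rewrite lt_geF//; apply: taumono => //; exact: ltW.
  by have [|->] := dTh x; rewrite ?x0.
have ThetaE y : 0 < y < P -> exists2 x, 0 < x < pi & y = tau x.
  move=> /andP[y0 yP].
  have [|x] := @IVT R tau 0 pi y (ltW pi0) ctau; first by rewrite tau0 ge_min le_max (ltW y0) (ltW yP) orbT.
  rewrite in_itv/= => /andP[x0 xpi] e; exists x => //.
  rewrite !lt_neqAle x0 xpi !andbT; apply/andP; split; apply/eqP.
    by move=> x0'; move: y0; rewrite -e -x0' tau0 ltxx.
  by move=> x0'; move: yP; rewrite -e x0' ltxx.
have dTheta x : 0 < x < pi -> is_derive (tau x) 1 Theta (p * sin x `^ (p - 1))^-1.
  move=> x0; have [_ h] := dTh _ x0; apply: near_eq_is_derive h.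
  have /andP[xx xp] := x0.
  near=> z; rewrite /Theta.
  have -> : (z <= 0) = false.
    rewrite lt_geF//; near: z; apply: lt_nbhsr.
    by rewrite -tau0; apply: taumono => //; exact: ltW.
  have -> // : (P <= z) = false.
  by rewrite lt_geF//; near: z; apply: lt_nbhsl; apply: taumono => //; exact: ltW.
have cTheta : {within `[0, P], continuous Theta}.
  rewrite -tau0; apply: segment_can_le_continuous (ltW pi0) ctau _.
  by move=> x; rewrite in_itv; exact: ThK.
have Theta0 : Theta 0 = 0 by rewrite /Theta lexx.
have ThetaI x : 0 <= x <= P -> 0 <= Theta x <= pi.
  move=> /andP[]; rewrite le_eqVlt => /predU1P[<- _|x0].
    by rewrite Theta0 lexx ltW.
  rewrite le_eqVlt => /predU1P[->|xP]; first by rewrite ThK ?lexx ?ltW.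
  have [|t /andP[t0 tpi] ->] := ThetaE x; first by rewrite x0.
  by rewrite ThK !ltW.
exists P, (St \o Theta), (cos \o Theta), (fun x => (x - St (Theta x) * cos (Theta x)) / (al + 1)).
split => //.
- by rewrite /= Theta0 /St sin0 normr0 powR0// gt_eqF.
- by rewrite /= Theta0 cos0.
- by move=> x; apply: continuous_comp (cTheta x) _; exact: cSt.
- by move=> x; apply: continuous_comp (cTheta x) _; exact: continuous_cos.
- move=> x /ThetaE[t t0 ->] /=; have /andP[t0' tpi] := t0.
  by rewrite ThK ?ltW// /St powR_gt0// gtr0_norm s0.
- move=> x /ThetaE[t t0 ->]; have /andP[t0' tpi] := t0.
  have ThKt : Theta (tau t) = t by rewrite ThK ?ltW.
  have h : is_derive (tau t) 1 (St \o Theta)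
     (p * sin t `^ (p - 1) * cos t * (p * sin t `^ (p - 1))^-1).
    by apply: is_derive1_comp (dTheta _ t0); rewrite ThKt; exact: dSt.
  apply: is_derive_eq h _; rewrite /= ThKt mulrAC mulfV ?mul1r// gt_eqF//.
  exact: dtau0.
- move=> x /ThetaE[t t0 ->]; have /andP[t0' tpi] := t0.
  have ThKt : Theta (tau t) = t by rewrite ThK ?ltW.
  have sx := s0 _ t0.
  have h : is_derive (tau t) 1 (cos \o Theta)
     (- sin t * (p * sin t `^ (p - 1))^-1).
    by apply: is_derive1_comp (dTheta _ t0); rewrite ThKt; exact: is_derive_cos.
  apply: is_derive_eq h _; rewrite /= ThKt /St gtr0_norm// -powRrM mulNr.
  have -> : p * (2 * al - 1) = 1 - (p - 1) by rewrite mulrBr mulrCA (mulrC p) alp; ring.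
  rewrite (@powRB _ _ 1 (p - 1)); last by rewrite (gt_eqF sx) implybT.
  rewrite powRr1 ?ltW// invfM [p^-1]invrK; ring.
- move=> x /ThetaI /sin_ge0_pi s0'; rewrite /= /St ger0_norm// -powRrM mulrC.
  by rewrite alp powRr1// addrC cos2Dsin2.
- by move=> x; rewrite mulrC divfK// gt_eqF// addr_gt0.
- move=> q q0.
  pose k t : R := Yt t - q * `|sin t| `^ (1 + p).
  (* Since S^(al+1) = sin^(1+p), a zero of [k] is the angle sought. On [0, pi/2] the sine increases,
     so the mean value theorem bounds Yt t1 by p t1 sin(t1)^(1+p), and t1 <= al q / 2 gives p t1 <=
     q / 2 < q, hence k t1 < 0; at pi only Yt pi > 0 is left. *)
  pose t1 := Num.min (pi / 2) (al * q / 2).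
  have t10 : 0 < t1 by rewrite lt_min !divr_gt0// mulr_gt0.
  have t1pi : t1 <= pi / 2 by rewrite ge_min lexx.
  have t1q : p * t1 < q.
    have : t1 <= al * q / 2 by rewrite ge_min lexx orbT.
    move=> h; apply: le_lt_trans (ler_wpM2l (ltW p0) h) _.
    by rewrite mulrA mulrA (mulrC p) alp mul1r; lra.
  have ltpi x : x < t1 -> x < pi by lra.
  have sub : `[0, t1] `<=` `[0, pi].
    by move=> x /=; rewrite !in_itv/= => /andP[-> ?]/=; lra.
  have kt1 : k t1 < 0.
    have dY' x : x \in `]0, t1[ -> is_derive x 1 Yt (p * `|sin x| `^ (1 + p)).
      by rewrite in_itv/= => /andP[x0 /ltpi xpi]; apply: dYt; rewrite x0.
    have [c] := MVT t10 dY' (continuous_subspaceW sub cYt).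
    rewrite in_itv/= => /andP[c0 ct1]; rewrite Yt0 !subr0 /k => ->.
    have sc : 0 < sin c by rewrite s0// c0 ltpi.
    have sct : sin c < sin t1 by rewrite ltr_sin// in_itv/=; apply/andP; split; lra.
    have st : 0 < sin t1 := lt_trans sc sct.
    rewrite !gtr0_norm//.
    have h : sin c `^ (1 + p) <= sin t1 `^ (1 + p).
      by apply: ge0_ler_powR; rewrite ?nnegrE; try exact: ltW; lra.
    have h0 : 0 < sin t1 `^ (1 + p) by rewrite powR_gt0.
    have := ler_wpM2l (ltW (mulr_gt0 p0 t10)) h.
    have : p * t1 * sin t1 `^ (1 + p) < q * sin t1 `^ (1 + p) by rewrite ltr_pM2r.
    lra.
  have kpi : 0 < k pi.
    rewrite /k sinpi normr0 powR0; last by rewrite gt_eqF// addr_gt0.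
    rewrite mulr0 subr0; move: P0; rewrite /P /tau /St sinpi normr0 powR0 ?gt_eqF//.
    by rewrite mul0r add0r pmulr_rgt0// addr_gt0.
  have t1lepi : t1 <= pi by lra.
  have ck : {within `[t1, pi], continuous k}.
    have sub' : `[t1, pi] `<=` `[0, pi].
      by move=> x /=; rewrite !in_itv/= => /andP[? ->]; rewrite andbT; lra.
    move=> x; apply: cvgB; first exact: continuous_subspaceW sub' cYt x.
    apply: (@continuous_subspaceT _ _ _ (fun t => q * `|sin t| `^ (1 + p))) => z.
    apply: cvgM; first exact: cvg_cst.
    apply: (@continuous_comp _ _ _ sin (fun y : R => `|y| `^ (1 + p))).
      exact: continuous_sin.
    by apply: continuous_norm_powR; rewrite addr_gt0.
  have [|t] := @IVT R k t1 pi 0 t1lepi ck.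
    by rewrite ge_min le_max (ltW kt1) (ltW kpi) orbT.
  rewrite in_itv/= => /andP[t1t tpi] kt0.
  have t0 : 0 < t by lra.
  have {}tpi : t < pi.
    by rewrite lt_neqAle tpi andbT; apply/eqP => e; move: kpi; rewrite -e kt0 ltxx.
  exists (tau t).
    by rewrite -{1}tau0 !taumono// ltW.
  rewrite /= ThK ?ltW//.
  have -> : tau t - St t * cos t = Yt t * (al + 1) by rewrite /tau; ring.
  rewrite mulfK ?gt_eqF ?addr_gt0//; apply/eqP; rewrite -subr_eq0 -kt0 /k /St.
  by rewrite -powRrM mulrDr (mulrC p al) alp mulr1.
Unshelve. all: by end_near. Qed.

Section gentrig_theory.
Variables (R : realType) (al P : R) (S C Y : R -> R).
Implicit Types (q x : R).
Hypotheses (al1 : 1 <= al) (G : gentrig al P S C Y).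

Let al0 : 0 < al. Proof. exact: lt_le_trans ltr01 al1. Qed.
Let dS := gentrig_dS G.
Let dC := gentrig_dC G.
Let S_gt0 := gentrig_S_gt0 G.

Lemma gentrig_Spow x : 0 < x < P -> S x `^ (2 * al) + C x ^+ 2 = 1.
Proof.
move=> /[dup] x0 /andP[/ltW x0' /ltW xP].
rewrite -[RHS](gentrig_S2C2 G (x := x)) ?x0'//; congr (_ + _).
by rewrite (mulrC 2) powRrM powR_mulrn// powR_ge0.
Qed.

(** The Wronskian of [id] and [S]. It is the numerator of the derivative of [ratio], so its sign
    decides the invertibility of [ratio]. *)
Definition gsym x := S x - x * C x.

Let within_sub (f : R -> R) x : x < P -> {within `[0, P], continuous f} ->
  {within `[0, x], continuous f}.
Proof.
move=> xP; apply: continuous_subspaceW => z/=; rewrite !in_itv/= => /andP[-> zx].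
by rewrite (le_trans zx (ltW xP)).
Qed.

Let gsym_cont : {within `[0, P], continuous gsym}.
Proof.
move=> x; apply: cvgB; first exact: gentrig_Scont G x.
apply: cvgM; last exact: gentrig_Ccont G x.
exact: (@continuous_subspaceT _ _ _ id (fun z => cvg_id)).
Qed.

Lemma is_derive_gsym x : 0 < x < P ->
  is_derive x 1 gsym (x * (al * S x `^ (2 * al - 1))).
Proof.
move=> x0; have := is_derive_sub (dS x0) (is_derive_mul (is_derive_id x 1) (dC x0)).
by move/is_derive_eq; apply; ring.
Qed.

Lemma gsym0 : gsym 0 = 0.
Proof. by rewrite /gsym (gentrig_S0 G) mul0r subr0. Qed.

Lemma gsym_gt0 x : 0 < x < P -> 0 < gsym x.
Proof.
move=> /andP[x0 xP]; rewrite -gsym0.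
apply: (derive_gt0_lt x0 (within_sub xP gsym_cont) (df := fun z => z * (al * S z `^ (2 * al - 1)))).
- by move=> z /andP[z0 zx]; apply: is_derive_gsym; rewrite z0 (lt_trans zx).
- move=> z /andP[z0 zx]; rewrite !mulr_gt0// powR_gt0// S_gt0// z0.
  exact: lt_trans zx xP.
Qed.

(** The difference [D] of the two sides vanishes at 0, and its derivative al (2 al - 1) x S^(2 al -
    2) g is nonnegative because g is positive. *)
Let gsym_growth x : 0 < x < P ->
  x * (x * (al * S x `^ (2 * al - 1))) <= (2 * al + 1) * gsym x.
Proof.
move=> /andP[x0 xP].
have al1' := al1.
pose D z := (2 * al + 1) * gsym z - z * (z * (al * `|S z| `^ (2 * al - 1))).
suff : D 0 <= D x.
  rewrite /D gsym0 !mul0r mulr0 subr0 gtr0_norm ?S_gt0 ?x0//.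
  by rewrite subr_ge0.
pose dD z := al * (2 * al - 1) * (z * S z `^ (2 * al - 1 - 1) * gsym z).
have idc : {within `[0, P], continuous (@id R)}.
  exact: (@continuous_subspaceT _ _ _ id (fun z => cvg_id)).
have cSp : {within `[0, P], continuous ((fun y : R => `|y| `^ (2 * al - 1)) \o S)}.
  have cp : continuous (fun y : R => `|y| `^ (2 * al - 1)).
    by apply: continuous_norm_powR; lra.
  have cS := gentrig_Scont G.
  move=> z; apply: continuous_comp (cS z) _; exact: cp.
apply: (derive_ge0_le (ltW x0) (df := dD)).
- apply: (within_sub xP) => z; apply: cvgB.
    by apply: cvgM; [exact: cvg_cst|exact: gsym_cont].
  apply: cvgM; first exact: idc.
  apply: cvgM; first exact: idc.
  apply: cvgM; first exact: cvg_cst.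
  exact: cSp.
- move=> z /andP[z0 zx]; have zP : 0 < z < P by rewrite z0 (lt_trans zx).
  have Sz := S_gt0 zP.
  have h : is_derive z 1 (fun z => (2 * al + 1) * gsym z - z * (z * (al * S z `^ (2 * al - 1))))
     (dD z).
    have h1 := is_derive_cmul (2 * al + 1) (is_derive_gsym zP).
    have h2 := is_derive_cmul al (is_derive_powR (2 * al - 1) Sz (dS zP)).
    have h3 := is_derive_mul (is_derive_id z 1) (is_derive_mul (is_derive_id z 1) h2).
    apply: is_derive_eq (is_derive_sub h1 h3) _.
    rewrite /dD /gsym -(@mulr_powRB1 _ (S z) (2 * al - 1)) ?ltW//; last lra.
    by ring.
  apply: near_eq_is_derive h; near=> w; rewrite /D gtr0_norm//.
  near: w; apply: cvgr_gt (Sz); exact: is_derive_continuous (dS zP).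
- move=> z /andP[z0 zx]; have zP : 0 < z < P by rewrite z0 (lt_trans zx).
  rewrite /dD; apply: mulr_ge0; first by apply: mulr_ge0; lra.
  by rewrite !mulr_ge0 ?powR_ge0 ?(ltW z0)// ltW// gsym_gt0.
Unshelve. all: by end_near. Qed.

(** By [gsym_growth] the quotient g z / z^(2 al + 1) is nonincreasing; compare its values at t x and
    x. *)
Lemma gsym_ratio t x : 0 < t <= 1 -> 0 < x < P ->
  t `^ (2 * al + 1) * gsym x <= gsym (t * x).
Proof.
move=> /andP[t0 t1] /[dup] x0P /andP[x0 xP].
have al1' := al1.
have tx0 : 0 < t * x by rewrite mulr_gt0.
have txx : t * x <= x by rewrite ger_pMl.
pose D z := - (gsym z / z `^ (2 * al + 1)).
suff : D (t * x) <= D x.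
  rewrite /D lerN2 (powRM _ (ltW t0) (ltW x0)) => h.
  have xp : 0 < x `^ (2 * al + 1) by rewrite powR_gt0.
  have tp : 0 < t `^ (2 * al + 1) by rewrite powR_gt0.
  have := ler_wpM2r (ltW (mulr_gt0 tp xp)) h.
  by rewrite mulrCA !divfK ?gt_eqF// mulr_gt0.
pose dD z := ((2 * al + 1) * gsym z - z * (z * (al * S z `^ (2 * al - 1))))
  * z `^ (2 * al) / z `^ (2 * al + 1) ^+ 2.
have dDz z : 0 < z < P -> is_derive z 1 D (dD z).
  move=> /[dup] zP /andP[z0 _].
  have zp : z `^ (2 * al + 1) != 0 by rewrite gt_eqF// powR_gt0.
  have h := is_derive_powR (2 * al + 1) z0 (is_derive_id z 1).
  have := is_derive_cmul (-1) (is_derive_div (g := fun y => y `^ (2 * al + 1)) zp (is_derive_gsym zP) h).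
  rewrite (_ : (fun y => _) = D); last by apply/funext => y; rewrite /D mulN1r.
  move/is_derive_eq; apply; rewrite /dD addrK mulN1r -mulNr; congr (_ / _).
  by rewrite -[in LHS](@mulr_powRB1 _ z (2 * al + 1)) ?ltW// ?addrK; [ring|lra].
apply: (derive_ge0_le txx (df := dD)).
- exact: (@within_continuous_derive _ D dD 0 P).
- by move=> z /andP[z0 zx]; apply: dDz; rewrite (lt_trans tx0 z0) (lt_trans zx).
- move=> z /andP[z1 zx]; have z0 : 0 < z := lt_trans tx0 z1.
  rewrite /dD divr_ge0 ?exprn_ge0 ?powR_ge0// mulr_ge0 ?powR_ge0//.
  by rewrite subr_ge0 gsym_growth// z0 (lt_trans zx).
Qed.

End gentrig_theory.

(** * Slope coordinate, distance profile and Jacobian bound *)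

Section profile.
Variables (R : realType) (al P : R) (S C Y : R -> R).
Implicit Types (q x : R).
Hypotheses (al1 : 1 <= al) (G : gentrig al P S C Y).

Let al0 : 0 < al. Proof. exact: lt_le_trans ltr01 al1. Qed.
Let dS := gentrig_dS G.
Let dC := gentrig_dC G.
Let S_gt0 := gentrig_S_gt0 G.
Local Notation g := (gsym S C).

Lemma is_derive_Y x : 0 < x < P -> is_derive x 1 Y (S x `^ (2 * al)).
Proof.
move=> xP; have al1' := al1.
have YE : Y = fun x => (al + 1)^-1 * (x - S x * C x).
  by apply/funext => z; rewrite -(gentrig_Y G) mulKf// gt_eqF//; lra.
rewrite YE; apply: is_derive_eq.
  exact: is_derive_cmul (is_derive_sub (is_derive_id x 1) (is_derive_mul (dS xP) (dC xP))).
have Sx := S_gt0 xP.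
have e : C x * C x = 1 - S x `^ (2 * al).
  by have := gentrig_Spow G xP; rewrite expr2; lra.
apply: (canLR (mulKf _)); first by rewrite gt_eqF//; lra.
rewrite e -(@mulr_powRB1 _ (S x) (2 * al)) ?ltW//; last lra.
by ring.
Qed.

(* The coordinate [q] on the geodesic [(S, Y)]. *)
Definition ratio x := Y x / S x `^ (al + 1).

(** The numerator S^(2 al + 1) - (al + 1) Y C equals S (1 - C^2) - (x - S C) C = S - x C. *)
Lemma is_derive_ratio x : 0 < x < P ->
  is_derive x 1 ratio (g x / S x `^ (al + 2)).
Proof.
move=> xP; have al1' := al1.
have Sx := S_gt0 xP.
have Sp c : 0 < S x `^ c by rewrite powR_gt0.
apply: is_derive_eq.
  apply: (is_derive_div (g := fun y => S y `^ (al + 1)) _ (is_derive_Y xP)).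
    by rewrite gt_eqF.
  exact: is_derive_powR (dS xP).
have SE c : S x `^ (c + 1) = S x * S x `^ c.
  by rewrite addrC powRD ?powRr1 ?ltW// (gt_eqF Sx) implybT.
have -> : al + 2 = al + 1 + 1 by ring.
rewrite addrK !SE.
have YE : (al + 1) * Y x = x - S x * C x by exact: gentrig_Y G x.
have e : S x `^ (2 * al) = 1 - C x * C x.
  by have := gentrig_Spow G xP; rewrite expr2; lra.
have -> : S x `^ (2 * al) * (S x * S x `^ al) -
  Y x * ((al + 1) * S x `^ al * C x) =
  S x `^ al * (S x * S x `^ (2 * al) - ((al + 1) * Y x) * C x) by ring.
rewrite YE e /gsym; field.
by rewrite !gt_eqF.
Qed.

Lemma ratio_gt0 x : 0 < x < P -> 0 < ratio x.
Proof.
move=> xP; have /andP[x0 xP'] := xP.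
rewrite divr_gt0//; last by rewrite powR_gt0// S_gt0.
rewrite -(@pmulr_rgt0 _ (al + 1)) ?addr_gt0// (gentrig_Y G).
have -> : 0 = 0 - S 0 * C 0 by rewrite (gentrig_S0 G) mul0r subr0.
pose f z := z - S z * C z.
have cf : {within `[0, P], continuous f}.
  move=> z; apply: cvgB; last first.
    by apply: cvgM; [exact: gentrig_Scont G z|exact: gentrig_Ccont G z].
  exact: (@continuous_subspaceT _ _ _ id (fun z => cvg_id)).
apply: (@derive_gt0_lt _ f (fun z => (al + 1) * S z `^ (2 * al)) _ _ x0).
- apply: continuous_subspaceW cf => z/=; rewrite !in_itv/= => /andP[-> zx].
  by rewrite (le_trans zx (ltW xP')).
- move=> z /andP[z0 zx]; have zP : 0 < z < P by rewrite z0 (lt_trans zx).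
  rewrite (_ : f = fun z => (al + 1) * Y z); last first.
    by apply/funext => w; rewrite (gentrig_Y G).
  exact: is_derive_cmul (is_derive_Y zP).
- move=> z /andP[z0 zx]; have zP : 0 < z < P by rewrite z0 (lt_trans zx).
  by rewrite mulr_gt0 ?powR_gt0 ?S_gt0 ?addr_gt0.
Qed.

(** [phi] inverts [ratio]: phi q is the parameter at which the geodesic (S, Y) meets the curve y = q
    x^(al+1). *)
Lemma profile_exists : exists phi : R -> R, forall q, 0 < q ->
  [/\ 0 < phi q < P, ratio (phi q) = q &
      is_derive q 1 phi (S (phi q) `^ (al + 2) / g (phi q))].
Proof.
have dr0 x : 0 < x < P -> 0 < g x / S x `^ (al + 2).
  by move=> xP; rewrite divr_gt0 ?powR_gt0 ?S_gt0// (gsym_gt0 al1 G).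
have [phi phiK] := derive_inverse_oo is_derive_ratio dr0.
exists phi => q q0; have [x xP e] := gentrig_surj G q0.
have rx : ratio x = q.
  by rewrite /ratio e mulfK// gt_eqF// powR_gt0// S_gt0.
have [] := phiK x xP; rewrite rx => -> d; split => //.
by move: d; rewrite invf_div.
Qed.

Section with_phi.
Variable phi : R -> R.
Hypothesis phiP : forall q, 0 < q ->
  [/\ 0 < phi q < P, ratio (phi q) = q &
      is_derive q 1 phi (S (phi q) `^ (al + 2) / g (phi q))].

(* The function [F] of the lower bound [x F (y / x^(al+1))] on lengths. *)
Definition profile q := phi q / S (phi q).

(** The quotient rule gives phi' (S - phi C) / S^2, and the factor g = S - phi C cancels the
    denominator of phi'. *)
Lemma is_derive_profile q : 0 < q ->
  is_derive q 1 profile (S (phi q) `^ al).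
Proof.
move=> /phiP[pP _ dphi]; have Sx := S_gt0 pP.
have gx : 0 < g (phi q) by exact: gsym_gt0 al1 G _ pP.
apply: is_derive_eq.
  apply: (is_derive_div (g := fun y => S (phi y)) _ dphi); first by rewrite gt_eqF.
  exact: is_derive_comp (dS pP) dphi.
have -> : S (phi q) `^ (al + 2) = S (phi q) `^ al * S (phi q) ^+ 2.
  by rewrite powRD ?powR_mulrn ?ltW// (gt_eqF Sx) implybT.
rewrite -/(gsym S C _).
have gE : g (phi q) = S (phi q) - phi q * C (phi q) by [].
rewrite gE; rewrite gE in gx; field.
by rewrite !gt_eqF.
Qed.

(** The left side is the x-derivative of x F(y / x^(al+1)), and S(phi q)^al is x^al times its
    y-derivative; the eikonal equation is therefore S^(2 al) + C^2 = 1. *)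
Lemma profile_eikonal q : 0 < q ->
  profile q - (al + 1) * q * S (phi q) `^ al = C (phi q).
Proof.
move=> /phiP[pP rq _]; have Sx := S_gt0 pP.
rewrite -{2}rq /ratio /profile.
have -> : S (phi q) `^ (al + 1) = S (phi q) * S (phi q) `^ al.
  by rewrite addrC powRD ?powRr1 ?ltW// (gt_eqF Sx) implybT.
rewrite mulrA (gentrig_Y G); field.
by rewrite !gt_eqF ?powR_gt0.
Qed.

Section contraction.
Variable t : R.
Hypothesis t01 : 0 < t <= 1.

Definition shrink q := S (t * phi q) / S (phi q).
Definition slide q := ratio (t * phi q).
Definition dslide q :=
  g (t * phi q) / S (t * phi q) `^ (al + 2) * (t * (S (phi q) `^ (al + 2) / g (phi q))).

Lemma scaled_dom q : 0 < q -> 0 < t * phi q < P.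
Proof.
move=> /phiP[/andP[p0 pP] _ _]; have /andP[t0 t1] := t01.
by rewrite mulr_gt0//= (le_lt_trans _ pP)// ger_pMl.
Qed.

Lemma shrink_gt0 q : 0 < q -> 0 < shrink q.
Proof.
move=> q0; rewrite divr_gt0 ?S_gt0 ?scaled_dom//.
by have [] := phiP q0.
Qed.

Lemma slide_gt0 q : 0 < q -> 0 < slide q.
Proof. by move=> q0; exact/ratio_gt0/scaled_dom. Qed.

Lemma is_derive_slide q : 0 < q -> is_derive q 1 slide (dslide q).
Proof.
move=> q0; have [pP _ dphi] := phiP q0.
exact: (@is_derive_comp _ ratio (fun y => t * phi y) q _ _
  (is_derive_ratio (scaled_dom q0)) (is_derive_cmul t dphi)).
Qed.

(** The Jacobian bound shrink^(al+2) * slide' >= t^(2 al + 2), in the form needed for integration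
    over q. After cancelling the powers of [S] it is [gsym_ratio] at phi q. *)
Lemma dslide_ge q : 0 < q ->
  (shrink q)^-1 `^ (al + 2) <= t `^ (- (2 * al + 2)) * dslide q.
Proof.
move=> q0; have [pP _ _] := phiP q0; have tP := scaled_dom q0.
have Sx := S_gt0 pP; have Stx := S_gt0 tP.
have gx := gsym_gt0 al1 G pP; have gtx := gsym_gt0 al1 G tP.
have /andP[t0 _] := t01.
rewrite /shrink invf_div powRM ?invr_ge0 ?(ltW Sx) ?(ltW Stx)//.
rewrite -[(S (t * phi q))^-1]powR_inv1 ?(ltW Stx)// -powRrM mulN1r !powRN.
have := gsym_ratio al1 G t01 pP.
set A := S (phi q) `^ (al + 2); set B := S (t * phi q) `^ (al + 2).
have A0 : 0 < A by rewrite powR_gt0.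
have B0 : 0 < B by rewrite powR_gt0.
have -> : t `^ (2 * al + 2) = t * t `^ (2 * al + 1).
  rewrite -{2}(powRr1 (ltW t0)) -powRD.
    by congr (_ `^ _); ring.
  by rewrite (gt_eqF t0) implybT.
set T := t `^ (2 * al + 1) => h; have T0 : 0 < T by rewrite powR_gt0.
have -> : (t * T)^-1 * dslide q = A / B * (g (t * phi q) / (T * g (phi q))).
  by rewrite /dslide -/A -/B; field; rewrite !gt_eqF.
rewrite ler_pMr ?divr_gt0// ler_pdivlMr ?mulr_gt0//.
by rewrite mul1r.
Qed.

Lemma continuous_shrink q : 0 < q -> {for q, continuous shrink}.
Proof.
move=> q0; have [pP _ dphi] := phiP q0.
have d1 := is_derive_comp (g := fun y => t * phi y)
  (dS (scaled_dom q0)) (is_derive_cmul t dphi).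
have n : S (phi q) != 0 by rewrite gt_eqF// S_gt0.
have d := is_derive_div (g := fun y => S (phi y)) n d1 (is_derive_comp (dS pP) dphi).
exact: (is_derive_continuous d).
Qed.

Lemma continuous_dslide q : 0 < q -> {for q, continuous dslide}.
Proof.
move=> q0; have [pP _ dphi] := phiP q0; have tP := scaled_dom q0.
have d1 := is_derive_comp (g := fun y => t * phi y) (is_derive_gsym G tP)
  (is_derive_cmul t dphi).
have d2 := is_derive_powR (al + 2) (S_gt0 tP)
  (is_derive_comp (g := fun y => t * phi y) (dS tP)
    (is_derive_cmul t dphi)).
have d3 := is_derive_powR (al + 2) (S_gt0 pP) (is_derive_comp (dS pP) dphi).
have d4 := is_derive_comp (is_derive_gsym G pP) dphi.
have n4 : g (phi q) != 0 by rewrite gt_eqF// (gsym_gt0 al1 G).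
have n2 : S (t * phi q) `^ (al + 2) != 0 by rewrite gt_eqF// powR_gt0// S_gt0.
have d5 := is_derive_div (g := fun y => S (t * phi y) `^ (al + 2)) n2 d1 d2.
have d6 := is_derive_cmul t (is_derive_div (g := fun y => g (phi y)) n4 d3 d4).
exact: (is_derive_continuous (is_derive_mul d5 d6)).
Qed.

End contraction.
End with_phi.
End profile.

(** * Integrals and Lipschitz functions *)

Section lower_integral.
Import HBNNSimple.
Context d (T : measurableType d) (R : realType).
Variable mu : {measure set T -> \bar R}.
Local Open Scope ereal_scope.
Implicit Types (D : set T) (f h : T -> \bar R).

(* The integral of a nonnegative function is the supremum over the simple
   functions below it, so [h] need not be measurable here. *)
Lemma ge0_le_integral_lower D f h : (forall x, D x -> 0 <= f x) ->
  (forall x, D x -> f x <= h x) ->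
  \int[mu]_(x in D) f x <= \int[mu]_(x in D) h x.
Proof.
move=> f0 fh; rewrite !ge0_integralE//; last first.
  by move=> x Dx; exact: le_trans (f0 _ Dx) (fh _ Dx).
apply: le_ereal_sup => _ [g /= gf <-]; exists g => // x.
apply: le_trans (gf x) _; rewrite !patchE; case: ifPn => //.
by rewrite inE; exact: fh.
Qed.

(** Here f is the measurable function, so the exceptional null set is removed on its side and [h]
    may be as irregular as [speed]. *)
Lemma ae_ge0_le_integral_lower D f h : measurable D -> measurable_fun D f ->
  (forall x, D x -> 0 <= f x) -> (forall x, D x -> 0 <= h x) ->
  {ae mu, forall x, D x -> f x <= h x} ->
  \int[mu]_(x in D) f x <= \int[mu]_(x in D) h x.
Proof.
move=> mD mf f0 h0 [N [mN N0 fhN]].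
rewrite (@ge0_negligible_integral _ _ _ mu D N f)//.
apply: (@le_trans _ _ (\int[mu]_(x in D) (f \_ (~` N)) x)).
  by rewrite setDE -integral_mkcondr.
apply: ge0_le_integral_lower => x Dx; rewrite patchE; case: ifPn => //.
  by move=> _; exact: f0.
  by rewrite inE => Nx; apply/not_notP => /= k; apply: Nx; apply: fhN => /(_ Dx).
by move=> _; exact: h0.
Qed.

(** Here the larger function is the measurable one: each simple function below f is compared with
    it, which bounds the supremum. *)
Lemma ae_ge0_integral_lower_le D f h : measurable D -> measurable_fun D h ->
  (forall x, D x -> 0 <= f x) -> (forall x, D x -> 0 <= h x) ->
  {ae mu, forall x, D x -> f x <= h x} ->
  \int[mu]_(x in D) f x <= \int[mu]_(x in D) h x.
Proof.
move=> mD mh f0 h0 fh.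
rewrite ge0_integralE//; apply: ge_ereal_sup => _ [g /= gf <-].
rewrite -integralT_nnsfun.
have gD x : D x -> (g x)%:E <= f x.
  by move=> Dx; have := gf x; rewrite patchE mem_set.
have gDC x : (~ D x) -> (g x)%:E = 0.
  move=> Dx; have := gf x; rewrite patchE memNset// => gx0.
  by apply/eqP; rewrite eq_le gx0 lee_fin fun_ge0.
have -> : \int[mu]_x (g x)%:E = \int[mu]_(x in D) (g x)%:E.
  rewrite [RHS]integral_mkcond; apply: eq_integral => x _; rewrite patchE.
  by case: ifPn => // /negP; rewrite inE => /gDC.
apply: ae_ge0_le_integral => //.
- by move=> x _; rewrite lee_fin fun_ge0.
- exact/measurable_EFinP/measurable_funTS.
- by apply: filterS fh => x fhx Dx; exact: le_trans (gD _ Dx) (fhx Dx).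
Qed.

End lower_integral.

Lemma lipschitz_continuous (R : realType) (L : R) (g : R -> R) :
  (forall x y, `|g x - g y| <= L * `|x - y|) -> continuous g.
Proof.
move=> gL x; apply/cvgrPdist_lt => e e0; near=> y.
have L1 : 0 < `|L| + 1 by rewrite ltr_pwDr.
apply: le_lt_trans (gL x y) _.
apply: (@le_lt_trans _ _ ((`|L| + 1) * `|x - y|)).
  by apply: ler_wpM2r => //; have := ler_norm L; lra.
rewrite mulrC -ltr_pdivlMr//; near: y; apply: cvgr_dist_lt; first exact: cvg_id.
by rewrite divr_gt0.
Unshelve. all: by end_near. Qed.

Lemma maxr_lipschitz (R : realType) (c x y : R) :
  `|Num.max c x - Num.max c y| <= `|x - y|.
Proof.
have h1 := ler_norm (x - y); have h2 := ler_norm (y - x); rewrite distrC in h2.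
by have [cx|cx] := leP c x; have [cy|cy] := leP c y; rewrite ler_norml; lra.
Qed.

Lemma minr_lipschitz (R : realType) (c x y : R) :
  `|Num.min x c - Num.min y c| <= `|x - y|.
Proof.
have h1 := ler_norm (x - y); have h2 := ler_norm (y - x); rewrite distrC in h2.
by have [cx|cx] := leP x c; have [cy|cy] := leP y c; rewrite ler_norml; lra.
Qed.

(** The extension is constant past both ends, so that difference quotients with steps leaving [0, T]
    make sense. *)
Lemma clamp_lipschitz (R : realType) (L T : R) (g : R -> R) : 0 <= T -> 0 <= L ->
  (forall x y, 0 <= x <= T -> 0 <= y <= T -> `|g x - g y| <= L * `|x - y|) ->
  exists f : R -> R, [/\ forall x y, `|f x - f y| <= L * `|x - y|,
    forall x, 0 <= x <= T -> f x = g x & forall x, T <= x -> f x = g T].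
Proof.
move=> T0 L0 gL; pose c (x : R) := Num.max 0 (Num.min x T).
have c0T x : 0 <= c x <= T by rewrite /c le_max lexx/= ge_max T0 ge_min lexx orbT.
exists (g \o c); split.
- move=> x y; apply: le_trans (gL _ _ (c0T x) (c0T y)) _; apply: ler_wpM2l => //.
  apply: le_trans (maxr_lipschitz _ _ _) _.
  exact: minr_lipschitz.
- by move=> x /andP[x0 xT]; rewrite /= /c (min_idPl xT) (max_idPr x0).
- by move=> x Tx; rewrite /= /c (min_idPr Tx) (max_idPr T0).
Qed.

Section lipschitz_integral.
Variable R : realType.
Local Notation mu := (@lebesgue_measure R).

#[export] Instance ae_lebesgue_filter : Filter (almost_everywhere mu).
Proof. exact: (@ae_filter_ringOfSetsType _ (measurableTypeR R)). Qed.

Lemma ae_interior (a b : R) :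
  {ae mu, forall x, x \in `[a, b] -> a < x < b}.
Proof.
have N0 : mu.-negligible [set a; b].
  apply/negligibleP; first by apply: measurableU; exact: measurable_set1.
  by apply: countable_lebesgue_measure0; exact/finite_set_countable/finite_set2.
apply: negligibleS N0 => x /= /not_implyP[]; rewrite in_itv/=.
move=> /andP[ax xb]; have [->|xa] := eqVneq x a; first by left.
have [->|xb'] := eqVneq x b; first by right.
by rewrite !lt_neqAle ax xb xb' (eq_sym a) xa.
Qed.

(* Reverse Fatou for the difference quotients of [f], whose integrals telescope
   through an antiderivative of [f]. *)
Lemma lipschitz_le_integral (L T : R) (g : R -> R) (h : R -> \bar R) :
  0 < T -> 0 <= L ->
  (forall x y, 0 <= x <= T -> 0 <= y <= T -> `|g x - g y| <= L * `|x - y|) ->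
  (forall x, 0 <= x <= T -> (0 <= h x)%E) ->
  {ae mu, forall x, x \in `[0, T] ->
     exists2 a : R, is_derive x 1 g a & (a%:E <= h x)%E} ->
  ((g T - g 0)%:E <= \int[mu]_(x in `[0%R, T]) h x)%E.
Proof.
move=> T0 L0 gL h0 gh.
have [f [fL fg fT]] := clamp_lipschitz (ltW T0) L0 gL.
have cf := lipschitz_continuous fL.
(* The margins leave room for the shifts x + e n, with e n <= 1. *)
have [F [_ _ dF]] := @antiderivative_exists R f (-1) (T + 2) cf ltac:(lra).
have cF x : -1 < x < T + 2 -> {for x, continuous F}.
  by move=> /dF; exact: is_derive_continuous.
have F_MVT (x e : R) : -1 < x -> 0 < e -> x + e < T + 2 ->
    exists2 c, x < c < x + e & F (x + e) - F x = f c * e.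
  move=> x1 e0 xe.
  have xxe : x < x + e by rewrite ltrDl.
  have H z : z \in `]x, x + e[ -> is_derive z 1 F (f z).
    by rewrite in_itv/= => /andP[xz ze]; apply: dF; rewrite (lt_trans x1)//= (lt_trans ze).
  have [] := MVT xxe H.
    exact: within_continuous_derive x1 xe dF.
  by move=> c; rewrite in_itv/= => xc ->; exists c => //; rewrite addrC addKr.
pose e (n : nat) : R := n.+1%:R^-1.
have e0 n : 0 < e n by rewrite invr_gt0.
have e1 n : e n <= 1 by rewrite invf_le1// ler1n.
pose q n x := (f (x + e n) - f x) / e n.
have cq n : continuous (q n).
  move=> x; apply: cvgM; last exact: cvg_cst.
  apply: cvgB; last exact: cf.
  apply: (@continuous_comp _ _ _ (fun y => y + e n) f); last exact: cf.
  by apply: cvgD; [exact: cvg_id|exact: cvg_cst].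
have qL n x : `|q n x| <= L.
  rewrite normrM normfV (gtr0_norm (e0 n)) ler_pdivrMr//.
  by have := fL (x + e n) x; rewrite addrAC subrr add0r (gtr0_norm (e0 n)).
(* Subtracting the quotients from L makes them nonnegative, as Fatou's lemma requires. *)
pose u n x : \bar R := (L - q n x)%:E.
have mD : measurable (`[0, T]%classic : set R) by exact: measurable_itv.
have mu_ n : measurable_fun (`[0, T]%classic : set R) (u n).
  apply/measurable_EFinP; apply: measurable_funTS.
  apply: continuous_measurable_fun => x.
  by apply: cvgB; [exact: cvg_cst|exact: cq].
have u0 n x : (0 <= u n x)%E.
  by rewrite lee_fin; have := qL n x; rewrite ler_norml; lra.
(* The integral of [q n] is the mean of f over [T, T + e n], which is g T, minus its mean over
   [0, e n], which differs from g 0 by at most L e n. *)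
have Iu n : (\int[mu]_(x in `[0%R, T]) u n x <=
    (L * T - (g T - g 0) + L * e n)%:E)%E.
  pose G x := L * x - (F (x + e n) - F x) / e n.
  have dG x : -1 < x -> x < T + 1 -> is_derive x 1 G (L - q n x).
    move=> x1 xT.
    have d1 : is_derive x 1 (fun y => F (y + e n)) (f (x + e n) * (1 + 0)).
      apply: (@is_derive_comp _ F (fun y => y + e n)).
      by apply: dF; have := e0 n; have := e1 n; lra.
    have d2 : is_derive x 1 F (f x) by apply: dF; lra.
    have d3 := is_derive_sub (is_derive_cmul L (is_derive_id x 1))
      (is_derive_cmul (e n)^-1 (is_derive_sub d1 d2)).
    rewrite (_ : G = fun y => L * y - (e n)^-1 * (F (y + e n) - F y)); last first.
      by apply/funext => y; rewrite /G mulrC [X in _ - X]mulrC mulrC.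
    by apply: is_derive_eq d3 _; rewrite /q; ring.
  rewrite /u (@continuous_FTC2 R _ G 0 T)//; first last.
  - move=> x; rewrite in_itv/= => /andP[x0 xT].
    by have [_ <-] := dG x ltac:(lra) ltac:(lra); rewrite derive1E.
  - split.
    + by move=> x; rewrite in_itv/= => /andP[x0 xT]; have [] := dG x ltac:(lra) ltac:(lra).
    + by apply: cvg_at_right_filter; apply: is_derive_continuous (dG 0 _ _); lra.
    + by apply: cvg_at_left_filter; apply: is_derive_continuous (dG T _ _); lra.
  - apply: continuous_subspaceT => x.
    by apply: cvgB; [exact: cvg_cst|exact: cq].
  rewrite -EFinB lee_fin /G.
  have [c /andP[c1 _] ->] := F_MVT T (e n) ltac:(lra) (e0 n) ltac:(have := e1 n; lra).
  have [c' /andP[c2 c3]] := F_MVT 0 (e n) ltac:(lra) (e0 n) ltac:(have := e1 n; lra).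
  rewrite !add0r => ->; rewrite !mulfK ?gt_eqF// mulr0 fT ?(ltW c1)//.
  have := fL c' 0; rewrite subr0 (gtr0_norm c2) (fg 0) ?lexx ?(ltW T0)// ler_norml.
  move: c3; rewrite add0r => /ltW/(ler_wpM2l L0); lra.
pose U x := limn_einf (u ^~ x).
have U0 x : (0 <= U x)%E.
  rewrite /U limn_einf_lim; apply: lime_ge; first exact: is_cvg_einfs.
  by apply: nearW => n; apply: le_ereal_inf_tmp => _ [k _ <-]; exact: u0.
have mU : measurable_fun (`[0, T]%classic : set R) U.
  apply: measurableT_comp => //; apply: measurable_fun_limn_esup => n.
  by apply: measurableT_comp => //; exact: mu_.
have IU : (\int[mu]_(x in `[0%R, T]) U x <= (L * T - (g T - g 0))%:E)%E.
  apply: le_trans (fatou mu mD mu_ (fun n x _ => u0 n x)) _.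
  pose v n : \bar R := (L * T - (g T - g 0) + L * e n)%:E.
  have vl : v @ \oo --> (L * T - (g T - g 0))%:E.
    apply: cvg_EFin; first exact: nearW.
    rewrite -[X in _ --> X]addr0; apply: cvgD; first exact: cvg_cst.
    rewrite -(mulr0 L); apply: cvgM; first exact: cvg_cst.
    exact: cvg_harmonic.
  have [<- _] := cvg_limn_einf_sup vl.
  rewrite !limn_einf_lim; apply: lee_lim; [exact: is_cvg_einfs..|].
  apply: nearW => n; apply: le_ereal_inf_tmp => _ [k /= nk <-].
  by apply: le_trans (Iu k); apply: ereal_inf_lbound; exists k.
(* A measurable function that is almost everywhere the positive part of g', hence lies below [h].
   The truncation keeps L <= m + U at every point. *)
pose m x := maxe 0%E (L%:E - U x)%E.
have mm : measurable_fun (`[0, T]%classic : set R) m.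
  by apply: measurable_maxe => //; apply: emeasurable_funB.
have m0 x : (0 <= m x)%E by rewrite /m le_max lexx.
have Lm x : (L%:E <= m x + U x)%E.
  have := U0 x; rewrite /m; case: (U x) => [r| |]//.
    move=> _; rewrite -EFinB; apply: (@le_trans _ _ ((L - r)%:E + r%:E)%E).
      by rewrite -EFinD subrK.
    by apply: leeD2r; rewrite le_max lexx orbT.
  by move=> _; rewrite addey ?leey// -ltNye (lt_le_trans _ (m0 x)) ?ltNyr//.
have mh : (\int[mu]_(x in `[0%R, T]) m x <= \int[mu]_(x in `[0%R, T]) h x)%E.
  have h0' x : `[0, T]%classic x -> (0 <= h x)%E by rewrite /= in_itv; exact: h0.
  apply: (@ae_ge0_le_integral_lower _ _ _ mu _ m h mD mm (fun x _ => m0 x) h0').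
  have := ae_interior 0 T; move: gh; apply: filterS2 => x gx xoo xD.
  have /andP[x0 xT] := xoo xD; have [a da ah] := gx xD.
  suff -> : m x = maxe 0%E a%:E by rewrite ge_max ah h0// (ltW x0) (ltW xT).
  have df : is_derive x 1 f a.
    apply: near_eq_is_derive da; near=> y; rewrite fg//; apply/andP; split; apply: ltW; near: y.
    - exact: lt_nbhsr.
    - exact: lt_nbhsl.
  have ql : q n x @[n --> \oo] --> a.
    have [df1 df2] := df; move: df1 => /cvg_ex[l /= fl].
    have la : l = a by rewrite -df2; apply/esym/cvg_lim.
    rewrite -la; move/cvgr_dnbhsP : fl => /(_ e) fl.
    apply: cvg_trans (fl _); last first.
      by split; [move=> n; rewrite gt_eqF|exact: cvg_harmonic].
    apply: near_eq_cvg; apply: nearW => n; rewrite /q /=.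
    by rewrite /GRing.scale/= mulr1 mulrC (addrC x).
  suff Ua : U x = (L - a)%:E by rewrite /m Ua -EFinB opprB addrC subrK.
  have ul : u ^~ x @ \oo --> (L - a)%:E.
    apply: cvg_EFin; first exact: nearW.
    by apply: cvgB; [exact: cvg_cst|exact: ql].
  by rewrite /U; have [] := cvg_limn_einf_sup ul.
have IL : (\int[mu]_(x in `[0%R, T]) L%:E = (L * T)%:E)%E.
  rewrite integral_cst//= lebesgue_measure_itv/= lte_fin T0 oppr0 addr0 -EFinM//.
have : ((L * T)%:E <= \int[mu]_(x in `[0%R, T]) m x + \int[mu]_(x in `[0%R, T]) U x)%E.
  rewrite -ge0_integralD// -IL; apply: ge0_le_integral => //.
  exact: emeasurable_funD.
move=> /le_trans /(_ (leeD mh IU)).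
set X := (\int[mu]_(x in _) h x)%E.
case: X => [r| |]; rewrite ?leey// -EFinD !lee_fin; lra.
Unshelve. all: by end_near. Qed.

End lipschitz_integral.

(** * Mean value bounds and a smoothed absolute value *)

Section calculus.
Variable R : realType.
Implicit Types (f df : R -> R) (x y K a b c p q s t : R).

Lemma derive_bound_lipschitz f df x y K :
  (forall z, Num.min x y <= z <= Num.max x y ->
     is_derive z 1 f (df z) /\ `|df z| <= K) ->
  `|f x - f y| <= K * `|x - y|.
Proof.
wlog xy : x y / x <= y.
  move=> H h; have [xy|yx] := leP x y; first exact: (H x y xy h).
  by rewrite distrC (distrC x); apply: (H y x (ltW yx)); rewrite minC maxC.
rewrite (min_idPl xy) (max_idPr xy) => h.
have dxy z : z \in `]x, y[ -> is_derive z 1 f (df z).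
  by rewrite in_itv/= => /andP[xz zy]; apply: (h _ _).1; rewrite !ltW.
have cf : {within `[x, y], continuous f}.
  apply: continuous_in_subspaceT => z; rewrite inE/= in_itv/= => xzy.
  exact: is_derive_continuous (h _ xzy).1.
have [z] := MVT_segment xy dxy cf; rewrite in_itv/= => zxy e.
rewrite distrC e normrM (distrC x); apply: ler_wpM2r => //; exact: (h _ zxy).2.
Qed.

(** Cauchy-Schwarz against the unit vector (c, s), by Lagrange's identity. The factors p and q are
    the slopes lost when a curve is replaced by its smoothed coordinates. *)
Lemma cauchy_schwarz_unit a b c s p q : s ^+ 2 + c ^+ 2 = 1 ->
  `|p| <= 1 -> `|q| <= 1 -> c * (a * p) + s * (b * q) <= Num.sqrt (a ^+ 2 + b ^+ 2).
Proof.
move=> sc p1 q1; set u := _ + s * _.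
apply: le_trans (ler_norm u) _; rewrite -sqrtr_sqr; apply: ler_wsqrtr.
have p2 : p ^+ 2 <= 1 by rewrite -real_normK ?num_real// expr_le1.
have q2 : q ^+ 2 <= 1 by rewrite -real_normK ?num_real// expr_le1.
apply: (@le_trans _ _ ((a * p) ^+ 2 + (b * q) ^+ 2)).
  have -> : (a * p) ^+ 2 + (b * q) ^+ 2 = ((a * p) ^+ 2 + (b * q) ^+ 2) * (s ^+ 2 + c ^+ 2).
    by rewrite sc mulr1.
  rewrite -subr_ge0 [X in 0 <= X](_ : _ = (s * (a * p) - c * (b * q)) ^+ 2) ?sqr_ge0//.
  by rewrite /u; ring.
by rewrite !exprMn lerD// ler_piMr// sqr_ge0.
Qed.

(** A differentiable, 1-Lipschitz and everywhere positive substitute for |x|, along which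
    [candidate] can be followed when a curve crosses an axis. *)
Definition smooth_abs (e x : R) := Num.sqrt (x ^+ 2 + e ^+ 2).

Lemma smooth_abs_gt0 e x : 0 < e -> 0 < smooth_abs e x.
Proof. by move=> e0; rewrite sqrtr_gt0 ltr_wpDl ?sqr_ge0// exprn_gt0. Qed.

Lemma smooth_abs_ge e x : 0 <= e -> e <= smooth_abs e x.
Proof.
by move=> e0; rewrite -{1}(ger0_norm e0) -sqrtr_sqr ler_wsqrtr// lerDr sqr_ge0.
Qed.

Lemma smooth_abs_norm_ge e x : `|x| <= smooth_abs e x.
Proof. by rewrite -sqrtr_sqr ler_wsqrtr// lerDl sqr_ge0. Qed.

Lemma smooth_abs0 e : 0 <= e -> smooth_abs e 0 = e.
Proof. by move=> e0; rewrite /smooth_abs expr0n add0r sqrtr_sqr ger0_norm. Qed.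

Lemma smooth_abs_le e x : 0 <= e -> smooth_abs e x <= `|x| + e.
Proof.
move=> e0; rewrite -[leRHS]ger0_norm ?addr_ge0// -sqrtr_sqr ler_wsqrtr//.
rewrite -(real_normK (num_real x)); have := mulr_ge0 (normr_ge0 x) e0.
by rewrite sqrrD; lra.
Qed.

Lemma is_derive_smooth_abs e f t a : 0 < e -> is_derive t 1 f a ->
  is_derive t 1 (fun s => smooth_abs e (f s)) (f t / smooth_abs e (f t) * a).
Proof.
move=> e0 df; have S0 := smooth_abs_gt0 (f t) e0.
have h0 : 0 < f t ^+ 2 + e ^+ 2 by rewrite -sqrtr_gt0.
have d2 := is_derive_add (is_derive_mul df df) (is_derive_cst (e ^+ 2) t 1).
have := @is_derive_comp _ Num.sqrt (fun s => f s * f s + e ^+ 2) t _ _ _ d2.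
move=> /(_ (2 * Num.sqrt (f t * f t + e ^+ 2))^-1); rewrite -expr2.
move=> /(_ (is_derive1_sqrt h0)).
rewrite (_ : (fun s => _) = fun s => smooth_abs e (f s)); last first.
  by apply/funext => s; rewrite /smooth_abs expr2.
move/is_derive_eq; apply; rewrite -/(smooth_abs e (f t)); field.
by rewrite gt_eqF.
Qed.

Lemma smooth_abs_slope e x : 0 < e -> `|x / smooth_abs e x| <= 1.
Proof.
move=> e0; have S0 := smooth_abs_gt0 x e0.
by rewrite normrM normfV (gtr0_norm S0) ler_pdivrMr// mul1r smooth_abs_norm_ge.
Qed.

Lemma smooth_abs_lipschitz e x y : 0 < e ->
  `|smooth_abs e x - smooth_abs e y| <= `|x - y|.
Proof.
move=> e0; rewrite -[leRHS]mul1r.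
apply: (@derive_bound_lipschitz _ (fun z => z / smooth_abs e z)) => z _.
split; last exact: smooth_abs_slope.
have := is_derive_smooth_abs e0 (is_derive_id z 1).
by move/is_derive_eq; apply; rewrite mulr1.
Qed.

End calculus.

Section pair_derive.
Variable R : realType.
Implicit Types (gamma : R -> R * R) (t : R) (v : R * R).

Lemma is_derive_fst gamma t v : is_derive t 1 gamma v ->
  is_derive t 1 (fun s => (gamma s).1) v.1.
Proof.
move=> [/cvg_ex[/= l gl] e]; have vl : l = v.
  by rewrite -e; apply/esym; exact: (cvg_lim (@norm_hausdorff _ _) gl).
have h : h^-1 *: ((gamma (h *: 1 + t)).1 - (gamma t).1) @[h --> 0^'] --> v.1.
  by rewrite -vl; apply: (@cvg_comp _ _ _ _ fst _ _ _ gl); exact: cvg_fst.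
by apply: DeriveDef; [apply/cvg_ex; exists v.1|exact/cvg_lim].
Qed.

Lemma is_derive_snd gamma t v : is_derive t 1 gamma v ->
  is_derive t 1 (fun s => (gamma s).2) v.2.
Proof.
move=> [/cvg_ex[/= l gl] e]; have vl : l = v.
  by rewrite -e; apply/esym; exact: (cvg_lim (@norm_hausdorff _ _) gl).
have h : h^-1 *: ((gamma (h *: 1 + t)).2 - (gamma t).2) @[h --> 0^'] --> v.2.
  by rewrite -vl; apply: (@cvg_comp _ _ _ _ snd _ _ _ gl); exact: cvg_snd.
by apply: DeriveDef; [apply/cvg_ex; exists v.2|exact/cvg_lim].
Qed.

Lemma is_derive_pair (f g : R -> R) t (a b : R) :
  is_derive t 1 f a -> is_derive t 1 g b ->
  is_derive t 1 (fun s => (f s, g s)) (a, b).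
Proof.
move=> [/cvg_ex[/= l fl] e] [/cvg_ex[/= k gk] e'].
have la : l = a by rewrite -e; apply/esym/cvg_lim.
have kb : k = b by rewrite -e'; apply/esym/cvg_lim.
have h : h^-1 *: ((f (h *: 1 + t), g (h *: 1 + t)) - (f t, g t)) @[h --> 0^'] --> (a, b).
  by rewrite -la -kb; exact: cvg_pair fl gk.
apply: DeriveDef; first by apply/cvg_ex; exists (a, b).
exact: (cvg_lim (@norm_hausdorff _ _) h).
Qed.

End pair_derive.

(** * Lower bounds on lengths *)

Section calibration.
Variables (R : realType) (al : R).
Local Notation mu := (@lebesgue_measure R).
Implicit Types (gamma : R -> R * R) (T t a b : R).

Lemma grushin_combE a b (p : R * R) :
  a *: grushinX p + b *: grushinY al p = (a, b * `|p.1| `^ al).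
Proof.
by apply/pair_equal_spec; split; rewrite /= /GRing.scale/= ?mulr1 mulr0 ?addr0 ?add0r.
Qed.

Lemma speed_ge0 gamma t : (0 <= speed al gamma t)%E.
Proof.
by apply: le_ereal_inf_tmp => _ [ab _ <-]; rewrite lee_fin sqrtr_ge0.
Qed.

Lemma horizontal_lipschitz T gamma : horizontal al T gamma ->
  exists2 L, 0 <= L & forall s t, 0 <= s <= T -> 0 <= t <= T ->
    `|gamma s - gamma t| <= L * `|s - t|.
Proof.
move=> [[L [_ gL]] _]; exists (Num.max L 0 + 1).
  by rewrite addr_ge0// le_max lexx orbT.
have LL : L < Num.max L 0 + 1 by rewrite ltr_pwDr// le_max lexx.
move=> s t sT tT.
by have /= := gL _ LL (s, t); apply; split; rewrite /= in_itv.
Qed.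

(** [speed] is an infimum over all pairs of controls giving the velocity, and on the singular axis
    there are many; hence the bound is assumed for every such pair. The derivative of g is the same
    number for all of them. *)
Lemma horizontal_calibration T gamma (g : R -> R) (L : R) :
  0 < T -> horizontal al T gamma -> 0 <= L ->
  (forall x y, 0 <= x <= T -> 0 <= y <= T -> `|g x - g y| <= L * `|x - y|) ->
  (forall t a b, 0 < t < T -> is_derive t 1 (fun s => (gamma s).1) a ->
     is_derive t 1 (fun s => (gamma s).2) (b * `|(gamma t).1| `^ al) ->
     exists2 d, is_derive t 1 g d & d <= Num.sqrt (a ^+ 2 + b ^+ 2)) ->
  ((g T - g 0)%:E <= grushin_length al T gamma)%E.
Proof.
move=> T0 [_ [a [b [_ _ dgamma]]]] L0 gL gcal.
apply: (lipschitz_le_integral T0 L0 gL) => [x _|]; first exact: speed_ge0.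
move: (ae_interior 0 T); move: dgamma; apply: filterS2 => t dg tT tI.
have {}dg := dg tI; have {}tT := tT tI; rewrite grushin_combE in dg.
have [d gd _] := gcal t _ _ tT (is_derive_fst dg) (is_derive_snd dg).
exists d => //; apply: le_ereal_inf_tmp => _ [[a' b'] /= e <-]; rewrite lee_fin.
have {}dg : is_derive t 1 gamma (a', b' * `|(gamma t).1| `^ al).
  by move: e; rewrite (grushin_combE a' b') => <-; apply: derivableP; case: dg.
have [d' gd' dle] := gcal t _ _ tT (is_derive_fst dg) (is_derive_snd dg).
by have [_ <-] := gd; have [_ ->] := gd'.
Qed.

End calibration.

Section distance_bound.
Variables (R : realType) (al : R).
Hypothesis al1 : 1 <= al.
Implicit Types (q x y e : R).
Variables F s c : R -> R.
Hypothesis dF : forall q : R, 0 < q -> is_derive q 1 F (s q).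
Hypothesis Fc : forall q : R, 0 < q -> F q - (al + 1) * q * s q = c q.
Hypothesis sc1 : forall q : R, 0 < q -> s q ^+ 2 + c q ^+ 2 = 1.
Hypothesis s_ge0 : forall q : R, 0 < q -> 0 <= s q.

Definition candidate (x y : R) := x * F (y / x `^ (al + 1)).

(** The gradient of [candidate] is (c q, s q / x^al): its first entry is [Fc], and [sc1] makes it a
    unit covector. *)
Lemma is_derive_candidate (X Y : R -> R) (t X' Y' : R) : 0 < X t -> 0 < Y t ->
  is_derive t 1 X X' -> is_derive t 1 Y Y' ->
  is_derive t 1 (fun z => candidate (X z) (Y z))
    (c (Y t / X t `^ (al + 1)) * X' +
     s (Y t / X t `^ (al + 1)) * (Y' / X t `^ al)).
Proof.
move=> X0 Y0 dX dY; set q := _ / _.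
have Xa : 0 < X t `^ al by rewrite powR_gt0.
have XE : X t `^ (al + 1) = X t * X t `^ al.
  by rewrite addrC powRD ?powRr1 ?ltW// (gt_eqF X0) implybT.
have q0 : 0 < q by rewrite divr_gt0// powR_gt0.
have n0 : X t `^ (al + 1) != 0 by rewrite gt_eqF// powR_gt0.
have d1 := is_derive_div (g := fun z => X z `^ (al + 1)) n0 dY (is_derive_powR (al + 1) X0 dX).
have d2 := is_derive_mul dX (is_derive_comp (g := fun z => Y z / X z `^ (al + 1)) (dF q0) d1).
apply: is_derive_eq d2 _; rewrite -Fc// addrK -/q.
have qE : Y t = q * (X t * X t `^ al) by rewrite /q XE divfK// gt_eqF// mulr_gt0.
rewrite XE qE; field.
by rewrite !gt_eqF.
Qed.

Let c_le1 q : 0 < q -> `|c q| <= 1.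
Proof.
move=> q0; rewrite -(@expr_le1 _ 2)// real_normK ?num_real//.
by have := sc1 q0; have := sqr_ge0 (s q); lra.
Qed.

Let s_le1 q : 0 < q -> `|s q| <= 1.
Proof.
move=> q0; rewrite -(@expr_le1 _ 2)// real_normK ?num_real//.
by have := sc1 q0; have := sqr_ge0 (c q); lra.
Qed.

Lemma candidate_lipschitz_l x x' y : 0 < x -> 0 < x' -> 0 < y ->
  `|candidate x y - candidate x' y| <= `|x - x'|.
Proof.
move=> x0 x0' y0; rewrite -[leRHS]mul1r.
apply: (@derive_bound_lipschitz _ (candidate ^~ y)
  (fun z => c (y / z `^ (al + 1)))) => z /andP[z0 _].
have {}z0 : 0 < z by apply: lt_le_trans z0; rewrite lt_min x0.
split; last by apply: c_le1; rewrite divr_gt0// powR_gt0.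
have := is_derive_candidate (X := id) (Y := cst y) z0 y0 (is_derive_id z 1) (is_derive_cst y z 1).
by move/is_derive_eq; apply; rewrite mul0r mulr0 addr0 mulr1.
Qed.

Lemma is_derive_candidate_r x y : 0 < x -> 0 < y ->
  is_derive y 1 (candidate x) (s (y / x `^ (al + 1)) / x `^ al).
Proof.
move=> x0 y0.
have := is_derive_candidate (X := cst x) (Y := id) x0 y0 (is_derive_cst x y 1) (is_derive_id y 1).
by move/is_derive_eq; apply; rewrite mulr0 add0r mul1r.
Qed.

(** The slope in y is at most x^(-al), which is bounded only away from the singular axis; hence the
    margin e. *)
Lemma candidate_lipschitz_r e x y y' : 0 < e -> e <= x -> 0 < y -> 0 < y' ->
  `|candidate x y - candidate x y'| <= (e `^ al)^-1 * `|y - y'|.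
Proof.
move=> e0 ex y0 y0'; have x0 := lt_le_trans e0 ex.
apply: (@derive_bound_lipschitz _ (candidate x)
  (fun z => s (z / x `^ (al + 1)) / x `^ al)) => z /andP[z0 _].
have {}z0 : 0 < z by apply: lt_le_trans z0; rewrite lt_min y0.
split; first exact: is_derive_candidate_r.
have ea : 0 < e `^ al by rewrite powR_gt0.
have xa : 0 < x `^ al by rewrite powR_gt0.
rewrite normrM normfV (gtr0_norm xa) -[leRHS]mul1r; apply: ler_pM => //.
- by rewrite invr_ge0 ltW.
- by apply: s_le1; rewrite divr_gt0// powR_gt0.
- rewrite lef_pV2 ?posrE//; apply: ge0_ler_powR => //; rewrite ?nnegrE; try exact: ltW.
  by have := al1; lra.
Qed.

Lemma candidate_le_r x y y' : 0 < x -> 0 < y -> y <= y' ->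
  candidate x y <= candidate x y'.
Proof.
move=> x0 y0 yy'; apply: (derive_ge0_le yy' (df := fun z => s (z / x `^ (al + 1)) / x `^ al)).
- apply: (@within_continuous_derive _ _ (fun z => s (z / x `^ (al + 1)) / x `^ al) 0 (y' + 1)) => //.
    by rewrite ltrDl.
  by move=> z /andP[z0 _]; exact: is_derive_candidate_r.
- by move=> z /andP[yz _]; apply: is_derive_candidate_r => //; exact: lt_trans yz.
- move=> z /andP[yz _]; rewrite divr_ge0 ?powR_ge0// s_ge0//.
  by rewrite divr_gt0 ?powR_gt0//; exact: lt_trans yz.
Qed.

(* The curve is pushed away from both singular axes [x = 0] and [y = y0], which
   does not increase its speed. *)
Lemma length_ge_candidate T (gamma : R -> R * R) (y0 x1 y1 : R) : 0 < T ->
  horizontal al T gamma -> gamma 0 = (0, y0) -> gamma T = (x1, y1) ->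
  x1 != 0 -> y1 != y0 ->
  ((candidate `|x1| `|y1 - y0|)%:E <= grushin_length al T gamma)%E.
Proof.
move=> T0 hg g0 gT x10 y10; apply/lee_addgt0Pr => e0 e00.
(* With h = e^(al+1) the smoothed curve starts at slope 1, where [candidate] is e F 1. A further e
   is lost at the other end, so e k = e0 covers both errors. *)
pose k := 1 + `|F 1|; have k0 : 0 < k by rewrite ltr_pwDl.
pose e := e0 / k; have e_gt0 : 0 < e by rewrite divr_gt0.
pose h := e `^ (al + 1); have h_gt0 : 0 < h by rewrite powR_gt0.
pose X t := smooth_abs e (gamma t).1.
pose Y t := smooth_abs h ((gamma t).2 - y0).
have X0 t : 0 < X t by exact: smooth_abs_gt0.
have Y0 t : 0 < Y t by exact: smooth_abs_gt0.
have Xe t : e <= X t by apply: smooth_abs_ge; exact: ltW.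
have [L L0 gL] := horizontal_lipschitz hg.
have ea : 0 < e `^ al by rewrite powR_gt0.
have lip x y : 0 <= x <= T -> 0 <= y <= T ->
    `|candidate (X x) (Y x) - candidate (X y) (Y y)| <=
    (L + (e `^ al)^-1 * L) * `|x - y|.
  move=> xT yT; have := gL _ _ xT yT; rewrite [X in X <= _ -> _]prod_normE ge_max => /andP[l1 l2].
  rewrite -(subrKA (candidate (X y) (Y x))); apply: le_trans (ler_normD _ _) _.
  rewrite mulrDl; apply: lerD.
    apply: le_trans (candidate_lipschitz_l _ _ _) _ => //.
    by apply: le_trans l1; exact: smooth_abs_lipschitz.
  apply: le_trans (candidate_lipschitz_r e_gt0 (Xe y) (Y0 _) (Y0 _)) _.
  rewrite -mulrA; apply: ler_wpM2l; first by rewrite invr_ge0 ltW.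
  apply: le_trans l2; apply: le_trans (smooth_abs_lipschitz _ _ h_gt0) _.
  by rewrite opprB addrA subrK.
have L'0 : 0 <= L + (e `^ al)^-1 * L by rewrite addr_ge0// mulr_ge0// invr_ge0 ltW.
have := horizontal_calibration T0 hg L'0 lip; set len := grushin_length _ _ _.
have cal t a b : 0 < t < T -> is_derive t 1 (fun s => (gamma s).1) a ->
     is_derive t 1 (fun s => (gamma s).2) (b * `|(gamma t).1| `^ al) ->
     exists2 d, is_derive t 1 (fun z => candidate (X z) (Y z)) d &
       d <= Num.sqrt (a ^+ 2 + b ^+ 2).
  move=> _ dx dy.
  have dX := is_derive_smooth_abs e_gt0 dx.
  have dY := is_derive_smooth_abs h_gt0 (is_derive_sub dy (is_derive_cst y0 t 1)).
  eexists; first exact: is_derive_candidate (X0 t) (Y0 t) dX dY.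
  set q := Y t / _; have q0 : 0 < q by rewrite divr_gt0// powR_gt0.
  rewrite /= subr0 (_ : s q * _ = s q * (b * (`|(gamma t).1| `^ al / X t `^ al *
    (((gamma t).2 - y0) / smooth_abs h ((gamma t).2 - y0))))); last by ring.
  rewrite (mulrC _ a); apply: cauchy_schwarz_unit (sc1 q0) _ _.
    exact: smooth_abs_slope.
  have Xa : 0 < X t `^ al by rewrite powR_gt0.
  rewrite normrM mulr_ile1 ?smooth_abs_slope//.
  rewrite normrM normfV (gtr0_norm Xa) ger0_norm ?powR_ge0// ler_pdivrMr// mul1r.
  have al1' := al1; apply: ge0_ler_powR; rewrite ?nnegrE ?(ltW (X0 t))//; first lra.
  exact: smooth_abs_norm_ge.
move=> /(_ cal) /=.
have -> : candidate (X 0) (Y 0) = e * F 1.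
  rewrite /X /Y g0 /= subrr !smooth_abs0 ?ltW// /candidate /h divff//.
  by rewrite gt_eqF// powR_gt0.
(* Smoothing increases both coordinates: [candidate] is monotone in y, and 1-Lipschitz in x, where
   the shift is at most e. *)
have : candidate `|x1| `|y1 - y0| - e <= candidate (X T) (Y T).
  rewrite /X /Y gT /=.
  have x1n : 0 < `|x1| by rewrite normr_gt0.
  have y1n : 0 < `|y1 - y0| by rewrite normr_gt0 subr_eq0.
  apply: (@le_trans _ _ (candidate (smooth_abs e x1) `|y1 - y0|)); last first.
    by apply: candidate_le_r => //; [exact: smooth_abs_gt0|exact: smooth_abs_norm_ge].
  have := candidate_lipschitz_l x1n (smooth_abs_gt0 x1 e_gt0) y1n.
  have := smooth_abs_le x1 (ltW e_gt0); have := smooth_abs_norm_ge e x1.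
  move=> h1 h2; rewrite (ler0_norm (_ : `|x1| - _ <= 0)) ?subr_le0//.
  by rewrite ler_norml => /andP[_]; lra.
have ee : e * k = e0 by rewrite /e divfK// gt_eqF.
have := ler_wpM2l (ltW e_gt0) (ler_norm (F 1)).
move: ee; rewrite /k; case: (len) => [r| |]; rewrite ?leey//.
- by rewrite -EFinD !lee_fin; lra.
Qed.

End distance_bound.

(** * The minimising geodesics *)

Section within.
Variable R : realType.
Implicit Types (f g : R -> R).

Lemma within_continuous_comp (A B : set R) f g : {within B, continuous f} ->
  {within A, continuous g} -> (forall x, A x -> B (g x)) ->
  {within A, continuous (fun x => f (g x))}.
Proof.
move=> cf cg AB; apply/subspace_continuousP => x Ax.
move/subspace_continuousP : cf => /(_ _ (AB _ Ax)) cf.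
move/subspace_continuousP : cg => /(_ _ Ax) cg.
apply: (@cvg_comp _ _ _ g f _ _ _ _ cf).
move=> U BU; have : nbhs x (fun z => A z -> (B (g z) -> U (g z))) by exact: cg BU.
by apply: filterS => z h Az; exact: h Az (AB _ Az).
Qed.

Lemma segment_bounded f (a b : R) : {within `[a, b], continuous f} ->
  exists2 K, 0 <= K & forall x, a <= x <= b -> `|f x| <= K.
Proof.
move=> cf; have := continuous_compact cf (@segment_compact _ a b).
move=> /compact_bounded[M [_ mM]]; exists (Num.max M 0 + 1).
  by rewrite addr_ge0// le_max lexx orbT.
move=> x xab; apply: (mM (Num.max M 0 + 1)); first by rewrite ltr_pwDr// le_max lexx.
by exists x => //=; rewrite in_itv.
Qed.

Lemma segment_lipschitz f df (a b : R) : {within `[a, b], continuous f} ->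
  {within `[a, b], continuous df} ->
  (forall x, a < x < b -> is_derive x 1 f (df x)) ->
  exists2 K, 0 <= K & forall x y, a <= x <= b -> a <= y <= b ->
    `|f x - f y| <= K * `|x - y|.
Proof.
move=> cf cdf dfx; have [K K0 dfK] := segment_bounded cdf; exists K => // x y.
wlog xy : x y / x <= y.
  move=> H xab yab; have [xy|yx] := leP x y; first exact: H.
  by rewrite distrC (distrC x); apply: (H y x (ltW yx)).
move=> /andP[ax xb] /andP[ay yb].
have dxy z : z \in `]x, y[ -> is_derive z 1 f (df z).
  rewrite in_itv/= => /andP[xz zy]; apply: dfx.
  by rewrite (le_lt_trans ax xz) (lt_le_trans zy yb).
have sub : `[x, y] `<=` `[a, b].
  by move=> z /=; rewrite !in_itv/= => /andP[xz zy]; rewrite (le_trans ax) ?(le_trans zy).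
have [z] := MVT_segment xy dxy (continuous_subspaceW sub cf).
move=> zxy e; rewrite distrC e normrM (distrC x); apply: ler_wpM2r => //.
by apply: dfK; have := sub z; rewrite /= !in_itv/=; apply; rewrite in_itv in zxy.
Qed.

End within.

Section explicit_curves.
Variables (R : realType) (al : R).
Hypothesis al1 : 1 <= al.
Local Notation mu := (@lebesgue_measure R).
Implicit Types t : R.
Variables x y a b : R -> R.
Hypothesis cx : {within `[0, 1], continuous x}.
Hypothesis cy : {within `[0, 1], continuous y}.
Hypothesis ca : {within `[0, 1], continuous a}.
Hypothesis cb : {within `[0, 1], continuous b}.
Hypothesis dx : forall t : R, 0 < t < 1 -> is_derive t 1 x (a t).
Hypothesis dy : forall t : R, 0 < t < 1 -> is_derive t 1 y (b t * `|x t| `^ al).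
Let gamma t := (x t, y t).

Let dgamma t : 0 < t < 1 ->
  is_derive t 1 gamma (a t *: grushinX (gamma t) + b t *: grushinY al (gamma t)).
Proof.
by move=> t01; rewrite grushin_combE; exact: is_derive_pair (dx t01) (dy t01).
Qed.

Let square_integrable_within (f : R -> R) : {within `[0, 1], continuous f} ->
  square_integrable `[0, 1] f.
Proof.
move=> cf; split.
  by apply: subspace_continuous_measurable_fun => //; exact: measurable_itv.
rewrite (_ : (fun t => _) = EFin \o (fun t => f t * f t)); last first.
  by apply/funext => t; rewrite /= expr2.
apply: continuous_compact_integrable; first exact: segment_compact.
by move=> t; apply: cvgM; exact: cf.
Qed.

Lemma curve_horizontal : horizontal al 1 gamma.
Proof.
split.
  have cb' : {within `[0, 1], continuous (fun t => b t * `|x t| `^ al)}.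
    have cp : continuous (fun z : R => `|z| `^ al).
      by apply: continuous_norm_powR; exact: lt_le_trans al1.
    have cxp := @within_continuous_comp _ _ setT _ _ (continuous_subspaceT cp) cx (fun _ _ => I).
    by move=> t; apply: cvgM; [exact: cb|exact: cxp].
  have [K K0 xK] := segment_lipschitz cx ca dx.
  have [M M0 yM] := segment_lipschitz cy cb' dy.
  exists (Num.max K M); split; first exact: num_real.
  move=> L LK [s t] [/= sT tT].
  rewrite /= in_itv in sT; rewrite /= in_itv in tT.
  rewrite prod_normE ge_max /=; move: LK; rewrite gt_max => /andP[KL ML].
  by rewrite (le_trans (xK _ _ sT tT)) ?(le_trans (yM _ _ sT tT))//; apply: ler_wpM2r => //; exact: ltW.
exists a, b; split; [exact: square_integrable_within..|].
by apply: filterS (ae_interior 0 1) => t tI /tI; exact: dgamma.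
Qed.

Lemma curve_speed_le t : 0 < t < 1 ->
  (speed al gamma t <= (Num.sqrt (a t ^+ 2 + b t ^+ 2))%:E)%E.
Proof.
move=> t01; apply: ereal_inf_lbound; exists (a t, b t) => //=.
by have [_ ->] := dgamma t01.
Qed.

(** Off the singular axis the two fields are independent, so the infimum runs over a single pair. *)
Lemma curve_speedE t : 0 < t < 1 -> x t != 0 ->
  speed al gamma t = (Num.sqrt (a t ^+ 2 + b t ^+ 2))%:E.
Proof.
move=> t01 xt; apply/eqP; rewrite eq_le curve_speed_le//=.
apply: le_ereal_inf_tmp => _ [[a' b'] /= e <-]; rewrite lee_fin.
have [_ de] := dgamma t01; rewrite de (grushin_combE _ _ _ (gamma t)) in e.
move: e; rewrite (grushin_combE _ _ _ (gamma t)) => -[-> /mulIf ->//].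
by rewrite powR_eq0 negb_and normr_eq0 xt.
Qed.

Lemma curve_length_le (V : R) :
  (forall t : R, 0 < t < 1 -> Num.sqrt (a t ^+ 2 + b t ^+ 2) <= V) ->
  (grushin_length al 1 gamma <= V%:E)%E.
Proof.
move=> sV; have V0 : 0 <= V.
  by apply: le_trans (sV 2^-1 _); rewrite ?sqrtr_ge0//; apply/andP; split; lra.
have mD : measurable (`[0, 1]%classic : set R) by exact: measurable_itv.
apply: (@le_trans _ _ (\int[mu]_(t in `[0%R, 1%R]) V%:E)%E); last first.
  by rewrite integral_cst//= lebesgue_measure_itv/= lte_fin ltr01 oppr0 adde0 mule1.
apply: ae_ge0_integral_lower_le => //.
- by move=> t _; exact: speed_ge0.
- apply: filterS (ae_interior 0 1) => t tI /tI t01.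
  by apply: le_trans (curve_speed_le t01) _; rewrite lee_fin sV.
Qed.

End explicit_curves.

Section geodesics.
Variables (R : realType) (al P : R) (S C Y : R -> R) (phi : R -> R).
Hypotheses (al1 : 1 <= al) (G : gentrig al P S C Y).
Implicit Types (q x t : R).
Hypothesis phiP : forall q, 0 < q ->
  [/\ 0 < phi q < P, ratio al S Y (phi q) = q &
      is_derive q 1 phi (S (phi q) `^ (al + 2) / gsym S C (phi q))].

Let al0 : 0 < al. Proof. exact: lt_le_trans ltr01 al1. Qed.

Section wave.
Variables y0 sx sy r w : R.
Hypotheses (r0 : 0 < r) (wP : 0 < w < P).
Hypotheses (sx2 : sx * sx = 1) (sy2 : sy * sy = 1) (sx_norm : `|sx| = 1).

Let w0 : 0 < w. Proof. by have /andP[] := wP. Qed.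

Definition wave_x t := sx * (r * S (w * t)).
Definition wave_y t := y0 + sy * (r `^ (al + 1) * Y (w * t)).
Definition wave_a t := sx * (r * w * C (w * t)).
Definition wave_b t := sy * (r * w * `|S (w * t)| `^ al).
Definition wave t := (wave_x t, wave_y t).
Local Notation x := wave_x.
Local Notation y := wave_y.
Local Notation a := wave_a.
Local Notation b := wave_b.

Let wt_dom t : 0 < t <= 1 -> 0 < w * t < P.
Proof.
move=> /andP[t0 t1]; have /andP[_ wP'] := wP.
by rewrite mulr_gt0//= (le_lt_trans _ wP')// ger_pMr.
Qed.

Let wt_dom' t : 0 < t < 1 -> 0 < w * t < P.
Proof. by move=> /andP[t0 t1]; apply: wt_dom; rewrite t0 ltW. Qed.

Let within_wt (f : R -> R) : {within `[0, P], continuous f} ->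
  {within `[0, 1], continuous (fun t => f (w * t))}.
Proof.
move=> cf; apply: (within_continuous_comp cf).
  apply: (@continuous_subspaceT _ _ _ (fun t => w * t)) => t.
  by apply: cvgM; [exact: cvg_cst|exact: cvg_id].
move=> t /=; rewrite !in_itv/= => /andP[t0 t1]; rewrite mulr_ge0 ?(ltW w0)//=.
by have /andP[_ /ltW] := wP; apply: le_trans; rewrite ger_pMr.
Qed.

Let within_cmul (c : R) (f : R -> R) : {within `[0, 1], continuous f} ->
  {within `[0, 1], continuous (fun t => c * f t)}.
Proof. by move=> cf t; apply: cvgM; [exact: cvg_cst|exact: cf]. Qed.

Let YE : Y = fun z => (al + 1)^-1 * (z - S z * C z).
Proof.
by apply/funext => z; rewrite -(gentrig_Y G) mulKf// gt_eqF// addr_gt0.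
Qed.

Let Ycont : {within `[0, P], continuous Y}.
Proof.
rewrite YE => t; apply: cvgM; first exact: cvg_cst.
apply: cvgB; last first.
  by apply: cvgM; [exact: gentrig_Scont G t|exact: gentrig_Ccont G t].
exact: (@continuous_subspaceT _ _ _ id (fun z => cvg_id)).
Qed.

Let cx : {within `[0, 1], continuous x}.
Proof. exact/within_cmul/within_cmul/within_wt/(gentrig_Scont G). Qed.

Let cy : {within `[0, 1], continuous y}.
Proof.
move=> t; apply: cvgD; first exact: cvg_cst.
exact: within_cmul (within_cmul (within_wt Ycont)) t.
Qed.

Let ca : {within `[0, 1], continuous a}.
Proof. exact/within_cmul/within_cmul/within_wt/(gentrig_Ccont G). Qed.

Let cb : {within `[0, 1], continuous b}.
Proof.
apply/within_cmul/within_cmul.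
have cp := continuous_norm_powR al0.
exact: (@within_continuous_comp _ _ setT _ _ (continuous_subspaceT cp)
  (within_wt (gentrig_Scont G)) (fun _ _ => I)).
Qed.

Let dx t : 0 < t < 1 -> is_derive t 1 x (a t).
Proof.
move=> /wt_dom' tP.
apply: is_derive_eq (is_derive_cmul sx (is_derive_cmul r
  (is_derive_scale_arg (gentrig_dS G tP)))) _.
by rewrite /a; ring.
Qed.

Let normx t : 0 < t <= 1 -> `|x t| = r * S (w * t).
Proof.
move=> tP; have := gentrig_S_gt0 G (wt_dom tP) => St.
by rewrite normrM sx_norm mul1r ger0_norm// mulr_ge0// ltW.
Qed.

Let powx t c : 0 < t <= 1 -> `|x t| `^ c = r `^ c * S (w * t) `^ c.
Proof.
move=> tP; rewrite normx// powRM// ltW//.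
exact: gentrig_S_gt0 G _ (wt_dom tP).
Qed.

Let rpow c : r `^ (c + 1) = r * r `^ c.
Proof. by rewrite addrC powRD ?powRr1 ?(ltW r0)// (gt_eqF r0) implybT. Qed.

Let dy t : 0 < t < 1 -> is_derive t 1 y (b t * `|x t| `^ al).
Proof.
move=> /[dup] t01 /wt_dom' tP; have St := gentrig_S_gt0 G tP.
have dY := is_derive_cmul sy (is_derive_cmul (r `^ (al + 1))
  (is_derive_scale_arg (is_derive_Y al1 G tP))).
apply: is_derive_eq (is_derive_add (is_derive_cst y0 t 1) dY) _.
rewrite powx; last by case/andP: t01 => -> /ltW.
rewrite /b (gtr0_norm St) rpow add0r.
have -> : S (w * t) `^ (2 * al) = S (w * t) `^ al * S (w * t) `^ al.
  by rewrite -powRD; [congr (_ `^ _); ring|rewrite (gt_eqF St) implybT].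
by ring.
Qed.

Let speedE t : 0 < t < 1 -> Num.sqrt (a t ^+ 2 + b t ^+ 2) = r * w.
Proof.
move=> /wt_dom' tP; have St := gentrig_S_gt0 G tP.
have rw0 : 0 <= r * w by exact: ltW (mulr_gt0 r0 w0).
rewrite -(ger0_norm rw0) -sqrtr_sqr; congr (Num.sqrt _).
rewrite /a /b (gtr0_norm St) -[RHS]mulr1 -(gentrig_S2C2 G (x := w * t)); last first.
  by case/andP: tP => /ltW-> /ltW.
transitivity ((r * w) ^+ 2 * ((sx * sx) * C (w * t) ^+ 2 + (sy * sy) * (S (w * t) `^ al) ^+ 2)).
  by ring.
by rewrite sx2 sy2; ring.
Qed.

Lemma wave0 : wave 0 = (0, y0).
Proof.
have Y0 : Y 0 = 0 by rewrite YE (gentrig_S0 G); ring.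
by rewrite /wave /x /y mulr0 (gentrig_S0 G) Y0 !mulr0 addr0.
Qed.

Lemma wave_geodesic : geodesic al `[0, 1] wave.
Proof.
(* The constant covector is y' / |x|^(2 al), where y' = sy w r^(al+1) S^(2 al) and |x|^(2 al) = r^(2
   al) S^(2 al). *)
exists a, (cst (sy * (w * r `^ (1 - al)))).
split; [exact: cx|exact: cy|exact: ca| |].
  by apply: continuous_subspaceT => t; exact: cvg_cst.
move=> t; rewrite interior_itv /= in_itv/= => t01; have tP := wt_dom' t01.
have St := gentrig_S_gt0 G tP.
have t01' : 0 < t <= 1 by case/andP: t01 => -> /ltW.
have rB c : r `^ (c - al) * r `^ al = r `^ c.
  by rewrite -powRD ?subrK// (gt_eqF r0) implybT.
have SB c d : S (w * t) `^ (c + d) = S (w * t) `^ c * S (w * t) `^ d.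
  by rewrite powRD// (gt_eqF St) implybT.
split.
- exact: dx.
- apply: is_derive_eq (dy t01) _; rewrite /= !powx//.
  rewrite /b (gtr0_norm St).
  have -> : 2 * al = al + al by ring.
  rewrite SB (@powRD _ r al al) ?(gt_eqF r0) ?implybT//.
  transitivity (sy * w * (r `^ (1 - al) * r `^ al) * r `^ al * S (w * t) `^ al * S (w * t) `^ al).
    by rewrite (rB 1) (powRr1 (ltW r0)); ring.
  by ring.
- apply: is_derive_eq (is_derive_cmul sx (is_derive_cmul (r * w)
    (is_derive_scale_arg (gentrig_dC G tP)))) _.
  rewrite /= powx// /x.
  have -> : 2 * al - 1 = 2 * (al - 1) + 1 by ring.
  rewrite SB powRr1 ?(ltW St)//.
  have e1 : r `^ (1 - al) * r `^ (1 - al) * r `^ (2 * (al - 1)) = 1.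
    rewrite -!powRD ?(gt_eqF r0) ?implybT//.
    by rewrite (_ : _ + _ = 0) ?powRr0//; ring.
  transitivity (- (al * (sy * sy) * w ^+ 2 * sx * r * S (w * t) `^ (2 * (al - 1)) * S (w * t)
    * (r `^ (1 - al) * r `^ (1 - al) * r `^ (2 * (al - 1))))).
    by rewrite e1 sy2; ring.
  by ring.
- exact: is_derive_cst.
Qed.

Lemma wave_horizontal : horizontal al 1 wave.
Proof. exact: (curve_horizontal al1 cx cy ca cb dx dy). Qed.

Lemma wave_length_le : (grushin_length al 1 wave <= (r * w)%:E)%E.
Proof. by apply: (curve_length_le dx dy) => t /speedE ->. Qed.

Lemma wave_constant_speed : constant_speed al 1 wave.
Proof.
exists (r * w).
apply: filterS (ae_interior 0 1) => t tI /tI t01.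
rewrite (curve_speedE dx dy t01) ?speedE//.
have t01' : 0 < t <= 1 by case/andP: t01 => -> /ltW.
by rewrite -normr_gt0 normx// mulr_gt0// (gentrig_S_gt0 G (wt_dom' t01)).
Qed.

End wave.

(** The end point forces w = phi q and r = |x1| / S w. The length is then at most r w = |x1| *
    profile q, which is the lower bound of [length_ge_candidate]. *)
Lemma minimising_geodesic_to (y0 x1 y1 : R)
    (q := `|y1 - y0| / `|x1| `^ (al + 1)) : x1 != 0 -> y1 != y0 ->
  exists gamma : R -> R * R,
  [/\ geodesic al `[0, 1] gamma, minimising al 1 gamma /\ constant_speed al 1 gamma,
    gamma 0 = (0, y0), gamma 1 = (x1, y1) &
    forall t, 0 < t <= 1 -> gamma t =
      (shrink S phi t q * x1, y0 + Num.sg (y1 - y0) * (slide al S Y phi t q *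
        `|shrink S phi t q * x1| `^ (al + 1)))].
Proof.
move=> x10 y10; have x1n : 0 < `|x1| by rewrite normr_gt0.
have y1n : 0 < `|y1 - y0| by rewrite normr_gt0 subr_eq0.
have q0 : 0 < q by rewrite divr_gt0// powR_gt0.
have [wP rq _] := phiP q0; have Sw := gentrig_S_gt0 G wP.
have [w wE] : exists w, w = phi q by exists (phi q).
rewrite -wE in wP rq Sw; have [r rE] : exists r, r = `|x1| / S w by exists (`|x1| / S w).
have r0 : 0 < r by rewrite rE divr_gt0.
have rS : r * S w = `|x1| by rewrite rE divfK// gt_eqF.
have [sx sxE] : exists sx, sx = Num.sg x1 by exists (Num.sg x1).
have [sy syE] : exists sy, sy = Num.sg (y1 - y0) by exists (Num.sg (y1 - y0)).
have sx2 : sx * sx = 1 by rewrite sxE -expr2 sqr_sg x10.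
have sy2 : sy * sy = 1 by rewrite syE -expr2 sqr_sg subr_eq0 y10.
have sx_norm : `|sx| = 1 by rewrite sxE normr_sg x10.
have sxx : sx * `|x1| = x1 by rewrite sxE mulr_sg_norm.
have syy : sy * `|y1 - y0| = y1 - y0 by rewrite syE mulr_sg_norm.
have gamma0 := wave0 y0 sx sy r w.
have gamma1 : wave y0 sx sy r w 1 = (x1, y1).
  rewrite /wave /wave_x /wave_y mulr1 rS sxx; congr (_, _).
  have -> : Y w = q * S w `^ (al + 1).
    by rewrite -rq /ratio divfK// gt_eqF// powR_gt0.
  rewrite (_ : r `^ _ * _ = `|y1 - y0|); first by rewrite syy addrC subrK.
  rewrite mulrCA -powRM ?(ltW r0) ?(ltW Sw)// rS.
  by rewrite /q divfK// gt_eqF// powR_gt0.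
exists (wave y0 sx sy r w); split => //.
- exact: wave_geodesic.
- split; last exact: wave_constant_speed.
  have hw : horizontal al 1 (wave y0 sx sy r w) by exact: wave_horizontal.
  split => //; apply/eqP; rewrite eq_le; apply/andP; split; last first.
    by apply: ereal_inf_lbound; exists 1, (wave y0 sx sy r w); split.
  apply: le_trans (wave_length_le y0 r0 wP sx2 sy2 sx_norm) _.
  rewrite gamma0 gamma1; apply: le_ereal_inf_tmp => _ [T [ga [T0 hga ga0 gaT ->]]].
  have dF q' : 0 < q' -> is_derive q' 1 (profile S phi) (S (phi q') `^ al).
    exact: (is_derive_profile al1 G phiP).
  have Fc q' : 0 < q' ->
      profile S phi q' - (al + 1) * q' * S (phi q') `^ al = C (phi q').
    exact: (profile_eikonal G phiP).
  have sc q' : 0 < q' -> S (phi q') `^ al ^+ 2 + C (phi q') ^+ 2 = 1.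
    by move=> /phiP[/andP[/ltW p0 /ltW pP] _ _]; rewrite (gentrig_S2C2 G)// p0.
  have := length_ge_candidate al1 dF Fc sc (fun q _ => powR_ge0 _ _) T0 hga ga0 gaT x10 y10.
  apply: le_trans; rewrite lee_fin /candidate -/q /profile -wE rE.
  by rewrite mulrAC mulrA.
- move=> t tP.
  have tw : 0 < t * w < P by rewrite wE; exact: (scaled_dom phiP tP q0).
  have St := gentrig_S_gt0 G tw.
  have e : r * S (w * t) = shrink S phi t q * `|x1|.
    by rewrite /shrink -wE (mulrC t) rE; ring.
  rewrite /wave; congr (_, _).
    by rewrite /wave_x e mulrCA sxx.
  rewrite /wave_y -syE; congr (_ + sy * _).
  rewrite normrM (gtr0_norm (shrink_gt0 G phiP tP q0)) -e [in RHS]powRM ?(ltW r0)//; last first.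
    by rewrite mulrC ltW.
  rewrite /slide /ratio -wE (mulrC t) mulrCA; congr (_ * _).
  by rewrite divfK// gt_eqF// powR_gt0// mulrC.
Qed.

End geodesics.

(** * Changes of variables in measure *)

Section affine.
Variable R : realType.
Local Notation mu := (@lebesgue_measure R).
Implicit Types (b c : R).

Lemma measurable_affine b c :
  measurable_fun [set: measurableTypeR R] (fun r : measurableTypeR R => c + b * r : measurableTypeR R).
Proof.
apply: continuous_measurable_fun => x; apply: cvgD; first exact: cvg_cst.
by apply: cvgM; [exact: cvg_cst|exact: cvg_id].
Qed.

(** By uniqueness of Lebesgue measure it suffices to treat half-open intervals; a negative b moves
    the closed end to the other side. *)
Lemma lebesgue_affine b c (A : set (measurableTypeR R)) : b != 0 -> measurable A ->
  mu A = (`|b|%:E * mu ((fun r => c + b * r)%R @^-1` A))%E.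
Proof.
move=> b0 mA.
pose f (r : measurableTypeR R) : measurableTypeR R := c + b * r.
have mf : measurable_fun setT f by exact: measurable_affine.
pose nu := measure_function_pushforward__canonical__measure_function_Measure mu mf.
transitivity (mscale (NngNum (normr_ge0 b)) nu A); last by [].
apply: lebesgue_measure_unique => //=.
move=> _ [[u v] _ <-].
rewrite /mscale /= /pushforward.
have [bp|bn] : 0 < b \/ b < 0 by move: b0; rewrite neq_lt => /orP[]; [right|left].
  rewrite (_ : f @^-1` _ = `](u - c) / b, (v - c) / b]%classic); last first.
    apply/seteqP; split => r; rewrite /= !in_itv/= /f ltr_pdivrMr// ler_pdivlMr// (mulrC r).
      by rewrite ltrBlDl lerBrDl.
    by rewrite ltrBlDl lerBrDl.
  rewrite !lebesgue_measure_itv /= !lte_fin ltr_pM2r ?invr_gt0// ltrD2r.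
  case: ifPn => _; rewrite ?mule0// (gtr0_norm bp) -!EFinB -EFinM; congr (_%:E).
  by field; rewrite gt_eqF.
rewrite (_ : f @^-1` _ = `[(v - c) / b, (u - c) / b[%classic); last first.
  apply/seteqP; split => r; rewrite /= !in_itv/= /f ltr_ndivlMr// ler_ndivrMr// (mulrC r).
    by rewrite ltrBlDl lerBrDl andbC.
  by rewrite ltrBlDl lerBrDl andbC.
rewrite !lebesgue_measure_itv /= !lte_fin ltr_nM2r ?invr_lt0// ltrD2r.
case: ifPn => _; rewrite ?mule0// (ltr0_norm bn) -!EFinB -EFinM; congr (_%:E).
by field; rewrite lt_eqF.
Qed.

Lemma ge0_integral_dilation b (f : measurableTypeR R -> \bar R) : 0 < b ->
  measurable_fun setT f -> (forall x, 0 <= f x)%E ->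
  (\int[mu]_x f x = b%:E * \int[mu]_x f (b * x)%R)%E.
Proof.
move=> b0 mf f0.
have b0' : b != 0 by rewrite gt_eqF.
pose g (r : measurableTypeR R) : measurableTypeR R := 0 + b * r.
have mg : measurable_fun setT g by exact: measurable_affine.
pose nu := measure_function_pushforward__canonical__measure_function_Measure mu mg.
transitivity (\int[mscale (NngNum (normr_ge0 b)) nu]_x f x)%E.
  apply: eq_measure_integral => A mA _; exact: (lebesgue_affine 0 b0').
rewrite ge0_integral_mscale//= ger0_norm ?(ltW b0)//; congr (_ * _)%E.
rewrite ge0_integral_pushforward//.
by rewrite preimage_setT; apply: eq_integral => x _; rewrite /= /g add0r.
Qed.

End affine.

(** * Change of variables for increasing maps of the half-line *)

Section expanding.
Variables (R : realType) (H dH w : R -> R) (c : R).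
Local Notation mu := (@lebesgue_measure R).
Implicit Types (q u v a b l m : R).
Hypothesis c0 : 0 < c.
Hypothesis dHP : forall q, 0 < q -> is_derive q 1 H (dH q).
Hypothesis dHc : forall q, 0 < q -> {for q, continuous dH}.
Hypothesis wc : forall q, 0 < q -> {for q, continuous w}.
Hypothesis w_gt0 : forall q, 0 < q -> 0 < w q.
Hypothesis w_le : forall q, 0 < q -> w q <= c * dH q.

Let w0 q : 0 < q -> 0 <= w q. Proof. by move=> /w_gt0/ltW. Qed.

Let D : set R := `]0, +oo[%classic.

Let DP q : D q <-> 0 < q.
Proof. by rewrite /D /= in_itv/= andbT. Qed.

Let mD : measurable D. Proof. exact: measurable_itv. Qed.

Let Hc q : 0 < q -> {for q, continuous H}.
Proof. by move=> q0; exact: is_derive_continuous (dHP q0). Qed.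

Let dH0 q : 0 < q -> 0 < dH q.
Proof.
by move=> q0; rewrite -(pmulr_rgt0 _ c0); exact: lt_le_trans (w_gt0 q0) (w_le q0).
Qed.

Let Hmono_lt u v : 0 < u -> u < v -> H u < H v.
Proof.
move=> u0 uv; apply: (derive_gt0_lt uv (df := dH)).
- apply: continuous_in_subspaceT => x; rewrite inE/= in_itv/= => /andP[ux _].
  exact/Hc/(lt_le_trans u0).
- by move=> x /andP[ux _]; exact/dHP/(lt_trans u0).
- by move=> x /andP[ux _]; exact/dH0/(lt_trans u0).
Qed.

Let Hmono u v : 0 < u -> u <= v -> H u <= H v.
Proof.
by move=> u0; rewrite le_eqVlt => /predU1P[->//|uv]; apply/ltW/Hmono_lt.
Qed.

Let pos_within (f : R -> R) u v : 0 < u ->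
  (forall q, 0 < q -> {for q, continuous f}) -> {within `[u, v], continuous f}.
Proof.
move=> u0 cf; apply: continuous_in_subspaceT => x; rewrite inE/= in_itv/= => /andP[ux _].
exact/cf/(lt_le_trans u0).
Qed.

Let measurable_pos (f : R -> R) :
  (forall q, 0 < q -> {for q, continuous f}) -> measurable_fun D f.
Proof.
move=> cf; apply: open_continuous_measurable_fun; first exact: interval_open.
by move=> q; rewrite inE => /DP; exact: cf.
Qed.

Lemma expand_segment u v : 0 < u -> u <= v ->
  (\int[mu]_(q in `[u, v]) (w q)%:E <= (c * (H v - H u))%:E)%E.
Proof.
move=> u0; rewrite le_eqVlt => /predU1P[->|uv].
  by rewrite set_itv1 integral_set1 subrr mulr0.
have pos q : q \in `[u, v] -> 0 < q.
  by rewrite in_itv/= => /andP[uq _]; exact: lt_le_trans u0 uq.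
have sub : `[u, v] `<=` D by move=> q /pos /DP.
have dcH q : 0 < q -> is_derive q 1 (fun q => c * H q) (c * dH q).
  by move=> q0; exact/is_derive_cmul/dHP.
have cdHc q : 0 < q -> {for q, continuous (fun q => c * dH q)}.
  by move=> q0; apply: cvgM; [exact: cvg_cst|exact: dHc].
have mI : measurable (`[u, v]%classic : set R) by exact: measurable_itv.
apply: (@le_trans _ _ (\int[mu]_(q in `[u, v]) (c * dH q)%:E)%E).
  apply: ge0_le_integral => //.
  - by move=> q /pos q0; rewrite lee_fin w0.
  - by apply/measurable_EFinP; apply: measurable_funS sub (measurable_pos wc).
  - by apply/measurable_EFinP; apply: measurable_funS sub (measurable_pos cdHc).
  - by move=> q /pos q0; rewrite lee_fin w_le.
rewrite (@continuous_FTC2 _ _ (fun q => c * H q) u v uv).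
- by rewrite -EFinB mulrBr.
- exact: pos_within.
- have cHc q : 0 < q -> {for q, continuous (fun q => c * H q)}.
    by move=> /dcH; exact: is_derive_continuous.
  split.
  + by move=> q; rewrite in_itv/= => /andP[uq _]; have [] := dcH q (lt_trans u0 uq).
  + by apply: cvg_at_right_filter; exact: cHc.
  + by apply: cvg_at_left_filter; apply: cHc; exact: lt_trans uv.
- move=> q; rewrite in_itv/= => /andP[uq _].
  by rewrite derive1E; have [_ ->] := dcH q (lt_trans u0 uq).
Qed.

Let integrand (B : set R) q : \bar R := (w q * \1_B (H q))%:E.

Let integrand_ge0 (B : set R) q : 0 < q -> (0 <= integrand B q)%E.
Proof. by move=> q0; rewrite lee_fin mulr_ge0// w0. Qed.

(** As H is increasing, the part of [l, m] that H maps into ]a, b] lies in a segment [u, v] along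
    which H grows by at most b - a. *)
Let expand_piece l m a b : 0 < l -> l <= m -> a <= b ->
  (\int[mu]_(q in `[l, m]) integrand `]a, b]%classic q <= (c * (b - a))%:E)%E.
Proof.
move=> l0 lm ab.
have m0 : 0 < m := lt_le_trans l0 lm.
have [u [v [u0 uvab uvP]]] : exists u v, [/\ 0 < u, u <= v -> H v - H u <= b - a &
    forall q, l <= q <= m -> a < H q <= b -> u <= q <= v].
  have [Hma|aHm] := leP (H m) a.
    (* A segment with u > v stands for an empty preimage. *)
    exists (m + 1), m; split; [by rewrite addr_gt0|by rewrite gerDl ler10|].
    move=> q /andP[lq qm] /andP[aq _]; have := Hmono (lt_le_trans l0 lq) qm.
    by move=> /le_trans/(_ Hma); rewrite leNgt aq.
  have [Hlb|bHl] := leP (H l) b; last first.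
    exists (l + 1), l; split; [by rewrite addr_gt0|by rewrite gerDl ler10|].
    move=> q /andP[lq qm] /andP[_ qb]; have := Hmono l0 lq.
    by move=> /le_trans/(_ qb); rewrite leNgt bHl.
  have cH : {within `[l, m], continuous H} by exact: pos_within.
  have [u lu [aHu uP]] : exists2 u, l <= u & a <= H u /\
      forall q, l <= q <= m -> a < H q -> u <= q.
    have [aHl|Hla] := leP a (H l).
      by exists l => //; split=> // q /andP[].
    have [|u] := @IVT _ H l m a lm cH.
      by rewrite ge_min le_max (ltW Hla) (ltW aHm) orbT.
    rewrite in_itv/= => /andP[lu um] Hu; exists u => //; rewrite Hu; split=> // q /andP[lq qm] aq.
    rewrite leNgt; apply/negP => qu; have := Hmono (lt_le_trans l0 lq) (ltW qu).
    by rewrite Hu leNgt aq.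
  have [v [Hvb vP]] : exists v, H v <= b /\ forall q, l <= q <= m -> H q <= b -> q <= v.
    have [Hmb|bHm] := leP (H m) b.
      by exists m; split=> // q /andP[].
    have [|v] := @IVT _ H l m b lm cH.
      by rewrite ge_min le_max Hlb (ltW bHm) orbT.
    rewrite in_itv/= => /andP[lv vm] Hv; exists v; rewrite Hv; split=> // q /andP[lq qm] qb.
    rewrite leNgt; apply/negP => vq; have := Hmono_lt (lt_le_trans l0 lv) vq.
    by rewrite Hv ltNge qb.
  exists u, v; split; first exact: lt_le_trans lu.
  - by move=> _; rewrite lerB.
  - by move=> q lqm /andP[aq qb]; rewrite uP// vP.
apply: (@le_trans _ _ (\int[mu]_(q in `[u, v]) (w q)%:E)%E).
  rewrite [leLHS]integral_mkcond [leRHS]integral_mkcond.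
  have posl q : `[l, m]%classic q -> 0 < q.
    by rewrite /= in_itv/= => /andP[lq _]; exact: lt_le_trans lq.
  have posu q : `[u, v]%classic q -> 0 < q.
    by rewrite /= in_itv/= => /andP[uq _]; exact: lt_le_trans uq.
  apply: ge0_le_integral_lower => q _; rewrite !patchE.
    by case: ifPn => //; rewrite inE => /posl; exact: integrand_ge0.
  case: ifPn => [|_]; last first.
    by case: ifPn => //; rewrite inE => /posu q0; rewrite lee_fin w0.
  rewrite inE => qlm; have q0 := posl _ qlm.
  rewrite /integrand indicE; case: ifPn => [_|].
    by rewrite lee_fin ler_piMr ?w0//; case: (_ \in _).
  move/negP; rewrite inE => quv; rewrite memNset ?mulr0// => Hab; apply: quv.
  by move: qlm Hab; rewrite /= !in_itv; exact: uvP.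
have [uv|vu] := leP u v.
  apply: le_trans (expand_segment u0 uv) _.
  by rewrite lee_fin ler_pM2l// uvab.
rewrite set_itv_ge ?bnd_simp -?ltNge// integral_set0 lee_fin.
by rewrite mulr_ge0 ?(ltW c0)// subr_ge0.
Qed.

Let measurable_integrand (B : set R) : measurable B ->
  measurable_fun D (integrand B).
Proof.
move=> mB; apply/measurable_EFinP/measurable_funM; first exact: measurable_pos.
apply: measurableT_comp; [exact: measurable_indic|exact: measurable_pos].
Qed.

Let D_bigcup : D = \bigcup_n (`[n.+1%:R^-1, n.+1%:R]%classic : set R).
Proof.
apply/seteqP; split => [q /DP q0|q [n _]]; last first.
  rewrite /= in_itv/= => /andP[nq _]; apply/DP; apply: lt_le_trans nq.
  by rewrite invr_gt0.
exists (Num.trunc (q + q^-1)) => //=; rewrite in_itv/=.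
have h := truncnS_gt (q + q^-1).
have qi0 : 0 < q^-1 by rewrite invr_gt0.
apply/andP; split; last by apply/ltW/(le_lt_trans _ h); rewrite lerDl ltW.
have hq : q^-1 <= (Num.trunc (q + q^-1)).+1%:R.
  by apply/ltW/(le_lt_trans _ h); rewrite lerDr ltW.
by rewrite -[leRHS]invrK lef_pV2 ?posrE.
Qed.

(** Monotone convergence along the compact segments [1/(n+1), n+1], on which [expand_piece] can use
    the intermediate value theorem. *)
Let expand_itv a b : a <= b ->
  (\int[mu]_(q in D) integrand `]a, b]%classic q <= (c * (b - a))%:E)%E.
Proof.
move=> ab; rewrite D_bigcup.
pose F n : set R := `[n.+1%:R^-1, n.+1%:R]%classic.
have FD n : F n `<=` D by rewrite D_bigcup; exact: bigcup_sup.
have mF n : measurable (F n) by exact: measurable_itv.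
have ndF : nondecreasing_seq F.
  move=> i j ij; apply/subsetPset => q; rewrite /F /= !in_itv/= => /andP[iq qi].
  rewrite (le_trans qi) ?ler_nat// andbT (le_trans _ iq)//.
  by rewrite lef_pV2 ?posrE// ler_nat.
have mB : measurable (`]a, b]%classic : set R) by exact: measurable_itv.
have cvgF : (\int[mu]_(q in F n) integrand `]a, b]%classic q)%E @[n --> \oo] -->
    (\int[mu]_(q in \bigcup_n F n) integrand `]a, b]%classic q)%E.
  apply: ge0_nondecreasing_set_cvg_integral => //.
    by move=> n; exact: measurable_funS mD (@FD n) (measurable_integrand mB).
  by move=> n q /FD/DP; exact: integrand_ge0.
rewrite -(cvg_lim _ cvgF)//; apply: lime_le; first by apply/cvg_ex; eexists; exact: cvgF.
apply: nearW => n; apply: expand_piece => //.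
by rewrite (le_trans (_ : _ <= 1)) ?invf_le1 ?ler1n.
Qed.

(** mu B is an infimum over countable covers by half-open intervals, and [expand_itv] bounds the
    contribution of each interval of a cover. *)
Lemma expand_measurable (B : set (measurableTypeR R)) : measurable B ->
  (\int[mu]_(q in D) (w q * \1_B (H q))%:E <= c%:E * mu B)%E.
Proof.
move=> mB; rewrite -lee_pdivrMl//; set I := integral _ _ _.
rewrite /lebesgue_measure /lebesgue_stieltjes_measure /measure_extension /mu_ext.
apply: le_ereal_inf_tmp => _ [A [mA BA] <-]; rewrite lee_pdivrMl// {}/I.
have mA' k : measurable (A k : set (measurableTypeR R)).
  by apply: sub_sigma_algebra; exact: mA.
apply: (@le_trans _ _ (\int[mu]_(q in D) \sum_(0 <= k <oo) integrand (A k) q)%E).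
  apply: ge0_le_integral_lower => q Dq; have q0 := (DP q).1 Dq.
    exact: (integrand_ge0 B q0).
  rewrite indicE; case: (boolP (_ \in _)) => [|_]; last first.
    by rewrite mulr0; apply: nneseries_ge0 => k _ _; exact: integrand_ge0.
  rewrite inE => /BA[k _ Ak]; rewrite mulr1.
  rewrite (@nneseriesD1 _ (fun k => integrand (A k) q) k)//; last first.
    by move=> j _; exact: integrand_ge0.
  rewrite {1}/integrand indicE mem_set// mulr1 leeDl//.
  by apply: nneseries_ge0 => j _ _; exact: integrand_ge0.
rewrite integral_nneseries//; last 2 first.
- by move=> k; exact: (measurable_integrand (mA' k)).
- by move=> k q Dq; exact: (integrand_ge0 (A k) ((DP q).1 Dq)).
rewrite -nneseriesZl//.
apply: lee_nneseries => [k _ _|k _].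
  by apply: integral_ge0 => q Dq; exact: (integrand_ge0 (A k) ((DP q).1 Dq)).
have [[a b] _ <-] := mA k.
have [ab|ba] := leP a b.
  by rewrite /= wlength_itv_bnd// -EFinM; exact: expand_itv.
rewrite /= set_itv_ge; last by rewrite bnd_simp -leNgt ltW.
rewrite wlength0 mule0 integral0_eq// => q _.
by rewrite /integrand indic0 mulr0.
Qed.

End expanding.

Lemma indic_iff (R : pzRingType) (U V : Type) (A : set U) (B : set V) (a : U) (b : V) :
  (A a <-> B b) -> \1_A a = \1_B b :> R.
Proof.
move=> [ab ba]; rewrite !indicE; congr (nat_of_bool _)%:R.
by apply/idP/idP; rewrite !inE.
Qed.

(** * The contraction of the plane in parabolic coordinates *)

Section plane_contraction.
Variables (R : realType) (al : R).
Hypothesis al1 : 1 <= al.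
Local Notation mu := (@lebesgue_measure R).
Local Notation T := (measurableTypeR R).
Local Notation mu2 := (mu \x mu)%E.
Variables (k H : T -> T) (c y0 s : R).
Implicit Types (x q : R) (M : set (T * T)).
Hypothesis c0 : 0 <= c.
Hypothesis s2 : s * s = 1.
Hypothesis mk : measurable_fun setT k.
Hypothesis mH : measurable_fun setT H.
Hypothesis k_gt0 : forall q, 0 < q -> 0 < k q.
Hypothesis H_gt0 : forall q, 0 < q -> 0 < H q.
Hypothesis expandH : forall B : set T, measurable B ->
  (\int[mu]_(q in `]0%R, +oo[) (k q `^ (- (al + 2)) * \1_B (H q))%:E <= c%:E * mu B)%E.

Let e x : R := `|x| `^ (al + 1).

Let e_ge0 x : 0 <= e x. Proof. exact: powR_ge0. Qed.

Let e0 : e 0 = 0.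
Proof. by rewrite /e normr0 powR0// gt_eqF// addr_gt0// (lt_le_trans _ al1). Qed.

Let e_gt0 x : x != 0 -> 0 < e x.
Proof. by move=> x0; rewrite powR_gt0// normr_gt0. Qed.

(** From the coordinates (x, q) back to the plane; the sign s selects the side of the line y =
    y0. *)
Definition parabolic (p : T * T) : T * T := (p.1, y0 + s * (p.2 * `|p.1| `^ (al + 1))).

Definition half_plane : set (T * T) := [set p | p.1 != 0 /\ 0 < s * (p.2 - y0)].

(** On [half_plane] the repeated quotient is the coordinate q of the point p. *)
Definition contraction (p : T * T) : T * T :=
  parabolic (k (s * (p.2 - y0) / `|p.1| `^ (al + 1)) * p.1,
    H (s * (p.2 - y0) / `|p.1| `^ (al + 1))).

Let m_e : measurable_fun [set: T] (e : T -> T).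
Proof.
by apply: continuous_measurable_fun; apply: continuous_norm_powR; have al1' := al1; lra.
Qed.

Let m_parabolic (d : measure_display) (X : measurableType d) (f g : X -> T) :
  measurable_fun setT f -> measurable_fun setT g ->
  measurable_fun setT (fun z => parabolic (f z, g z)).
Proof.
move=> mf mg; apply: measurable_fun_pair => //=.
apply: measurable_funD; first exact: measurable_cst.
apply: measurable_funM; first exact: measurable_cst.
by apply: measurable_funM => //; exact: (measurableT_comp m_e).
Qed.

Let mfst : measurable_fun [set: T * T] (fun p => p.1 : T).
Proof. exact: measurable_fst. Qed.
Let msnd : measurable_fun [set: T * T] (fun p => p.2 : T).
Proof. exact: measurable_snd. Qed.

Let m_slope : measurable_fun [set: T * T]
  (fun p => s * (p.2 - y0) / `|p.1| `^ (al + 1) : T).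
Proof.
apply: measurable_funM.
  apply: measurable_funM; first exact: measurable_cst.
  by apply: measurable_funB => //; exact: measurable_cst.
rewrite (_ : (fun p => _) = (fun x : T => `|x| `^ (- (al + 1)) : T) \o fst); last first.
  by apply/funext => p; rewrite /= powRN.
apply: measurableT_comp => //.
apply: (@measurableT_comp _ _ _ _ _ _ (fun x : T => x `^ (- (al + 1)) : T)).
  exact: measurable_powR.
exact: normr_measurable.
Qed.

Lemma measurable_contraction : measurable_fun [set: T * T] contraction.
Proof.
apply: m_parabolic; last exact: measurableT_comp.
by apply: measurable_funM => //; exact: measurableT_comp.
Qed.

Lemma measurable_half_plane : measurable half_plane.
Proof.
have -> : half_plane = (fst @^-1` [set~ (0 : T)]) `&`
    ((fun p : T * T => s * (p.2 - y0) : T) @^-1` `]0, +oo[).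
  apply/seteqP; split => p /=; rewrite in_itv/= andbT => -[h1 h2]; split => //.
    exact/eqP.
  exact/eqP.
apply: measurableI.
  rewrite -[X in measurable X]setTI; apply: mfst => //.
  by apply: measurableC; exact: measurable_set1.
rewrite -[X in measurable X]setTI.
have m : measurable_fun [set: T * T] (fun p : T * T => s * (p.2 - y0) : T).
  apply: measurable_funM; first exact: measurable_cst.
  by apply: measurable_funB => //; exact: measurable_cst.
by apply: m => //; exact: measurable_itv.
Qed.

(* For [x != 0] the substitution [y = y0 + s q |x|^(al+1)] parametrizes the
   vertical section by [q > 0]. *)
Let section_measure (A : set (T * T)) x : measurable A ->
  mu (xsection (A `&` half_plane) x) =
  ((e x)%:E * mu [set q : T | (0 < q)%R /\ A (parabolic (x, q))])%E.
Proof.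
move=> mA; have [->|x0] := eqVneq x 0.
  rewrite e0 mul0e (_ : xsection _ _ = set0) ?measure0//.
  by apply/seteqP; split => // y; rewrite /xsection/= inE => -[_ []]/=; rewrite eqxx.
have b0 : s * e x != 0.
  apply: mulf_neq0; last by rewrite gt_eqF// e_gt0.
  by apply/eqP => s0; move: s2; rewrite s0 mul0r => /eqP; rewrite eq_sym oner_eq0.
have s1 : `|s| = 1.
  apply/eqP; rewrite -(@eqrXn2 _ 2)// ?expr1n// real_normK ?num_real//.
  by rewrite expr2 s2.
rewrite (lebesgue_affine y0 b0); last first.
  by apply: measurable_xsection; apply: measurableI => //; exact: measurable_half_plane.
rewrite normrM s1 mul1r (ger0_norm (e_ge0 x)); congr (_ * mu _)%E.
apply/seteqP; split => q /=; rewrite /xsection/= inE.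
  move=> [Aq [/= _]]; rewrite addrC addKr -mulrA mulrA s2 mul1r pmulr_rgt0 ?e_gt0//.
  by move=> q0; split => //; move: Aq; rewrite /parabolic /= -mulrA (mulrC q).
move=> [q0 Aq]; split; first by move: Aq; rewrite /parabolic /= -mulrA (mulrC q).
by split => //=; rewrite addrC addKr -mulrA mulrA s2 mul1r mulr_gt0 ?e_gt0.
Qed.

Let mu2_half (A : set (T * T)) : measurable A ->
  mu2 (A `&` half_plane) =
  (\int[mu]_x ((e x)%:E * mu [set q : T | (0 < q)%R /\ A (parabolic (x, q))]))%E.
Proof. by move=> mA; apply: eq_integral => x _; exact: section_measure. Qed.

Let contraction_parabolic x q : x != 0 ->
  contraction (parabolic (x, q)) = parabolic (k q * x, H q).
Proof.
move=> x0; rewrite /contraction /= (_ : s * _ / _ = q)//.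
rewrite addrC addKr mulrA s2 mul1r mulfK// gt_eqF//; exact: e_gt0.
Qed.

Let pos : set (T * T) := [set p | 0 < p.2].

Let m_pos : measurable pos.
Proof.
have -> : pos = snd @^-1` `]0, +oo[ by apply/seteqP; split => p /=; rewrite in_itv/= andbT.
by rewrite -[X in measurable X]setTI; apply: msnd => //; exact: measurable_itv.
Qed.

Let m_preimage (f : T * T -> T * T) M : measurable_fun setT f -> measurable M ->
  measurable (f @^-1` M).
Proof. by move=> mf mM; rewrite -[X in measurable X]setTI; exact: mf. Qed.

(** Tonelli in the coordinates (x, q). For fixed q the dilation x -> k q x trades the factor [k q]
    for the weight (k q)^(-(al+2)): al + 1 powers come from the area element and one from dx. For
    fixed x the weighted integral in q is bounded by [expandH]. *)
Lemma contraction_measure M : measurable M ->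
  (mu2 ((contraction @^-1` M) `&` half_plane) <= c%:E * mu2 (M `&` half_plane))%E.
Proof.
move=> mM; have mCM : measurable (contraction @^-1` M).
  exact: m_preimage measurable_contraction mM.
rewrite !mu2_half//.
(* [TT] is the preimage of [M] under the full map in the coordinates (x, q), [VV] its preimage under
   the map that moves only q. *)
pose TT := pos `&` ((fun p : T * T => parabolic (k p.2 * p.1, H p.2)) @^-1` M).
pose VV := pos `&` ((fun p : T * T => parabolic (p.1, H p.2)) @^-1` M).
have mTT : measurable TT.
  apply: measurableI => //; apply: m_preimage => //; apply: m_parabolic.
    by apply: measurable_funM => //; exact: measurableT_comp.
  exact: measurableT_comp.
have mVV : measurable VV.
  by apply: measurableI => //; apply: m_preimage => //; apply: m_parabolic => //; exact: measurableT_comp.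
have me1 : measurable_fun [set: T * T] (fun p : T * T => e p.1 : T).
  exact: (measurableT_comp m_e).
pose w (q : T) : T := k q `^ (- (al + 2)).
have mw : measurable_fun [set: T] w.
  apply: (@measurableT_comp _ _ _ _ _ _ (fun x : T => x `^ (- (al + 2)) : T)).
    exact: measurable_powR.
  exact: mk.
pose W (p : T * T) : \bar R := (e p.1 * \1_TT p)%:E.
pose V (p : T * T) : \bar R := (w p.2 * (e p.1 * \1_VV p))%:E.
have mW : measurable_fun setT W.
  by apply/measurable_EFinP/measurable_funM => //; exact: measurable_indic.
have mV : measurable_fun setT V.
  apply/measurable_EFinP/measurable_funM; first exact: measurableT_comp.
  by apply: measurable_funM => //; exact: measurable_indic.
have W0 p : (0 <= W p)%E by rewrite lee_fin mulr_ge0.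
have V0 p : (0 <= V p)%E by rewrite lee_fin !mulr_ge0// powR_ge0.
have sectionZ (A : set (T * T)) x : measurable A ->
    (\int[mu]_q (e x * \1_A (x, q))%:E = (e x)%:E * mu (xsection A x))%E.
  move=> mA; have mAx : measurable (xsection A x) by exact: measurable_xsection.
  rewrite -[in RHS](setIT (xsection A x)) -integral_indic// -ge0_integralZl//; last 2 first.
  - by apply/measurable_EFinP; exact: measurable_indic.
  - by rewrite lee_fin.
  by apply: eq_integral => q _; rewrite -EFinM !indicE mem_xsection.
have E1 : (\int[mu]_x ((e x)%:E * mu [set q : T | (0 < q)%R /\
    (contraction @^-1` M) (parabolic (x, q))]) = \int[mu]_x \int[mu]_q W (x, q))%E.
  apply: eq_integral => x _; rewrite sectionZ//.
  have [->|x0] := eqVneq x 0; first by rewrite e0 !mul0e.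
  congr (_ * mu _)%E; apply/seteqP; split => q; rewrite /xsection /TT /= inE /=.
    by move=> [q0]; rewrite contraction_parabolic.
  by move=> [q0 ?]; rewrite contraction_parabolic.
have E2 q : (\int[mu]_x W (x, q) = \int[mu]_x V (x, q))%E.
  have [q0|q0] := ltP 0 q; last first.
    by rewrite !integral0_eq// => x _; rewrite /V /W indicE memNset ?mulr0//= => -[];
      rewrite /pos/= ltNge q0.
  have kq := k_gt0 q0.
  pose f (x : T) : \bar R := (e x * \1_M (parabolic (x, H q)))%:E.
  have mf : measurable_fun setT f.
    apply/measurable_EFinP/measurable_funM => //.
    apply: (@measurableT_comp _ _ _ _ _ _ (\1_M : T * T -> T)).
      exact: measurable_indic.
    by apply: m_parabolic.
  have f0 x : (0 <= f x)%E by rewrite lee_fin mulr_ge0.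
  have -> : (\int[mu]_x V (x, q) = (w q)%:E * \int[mu]_x f x)%E.
    rewrite -ge0_integralZl//; last by rewrite lee_fin powR_ge0.
    apply: eq_integral => x _; rewrite -EFinM /V /=; congr (_ * (_ * _))%:E.
    by apply: indic_iff; split=> [[]|].
  rewrite (ge0_integral_dilation kq mf f0) muleA -EFinM.
  rewrite -ge0_integralZl//; last 2 first.
  - have mkq : measurable_fun [set: T] (fun x : T => k q * x : T).
      by apply: measurable_funM => //; exact: measurable_cst.
    exact: (measurableT_comp mf mkq).
  - by rewrite lee_fin mulr_ge0 ?powR_ge0// ltW.
  apply: eq_integral => x _; rewrite /f /W /= -EFinM; congr (_%:E).
  rewrite /e normrM (gtr0_norm kq) powRM ?(ltW kq)//.
  have -> : \1_TT (x, q) = \1_M (parabolic (k q * x, H q)) :> R.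
    by apply: indic_iff; split=> [[]|].
  have e1 : w q * k q * k q `^ (al + 1) = 1.
    rewrite -[X in _ * X * _](powRr1 (ltW kq)) -!powRD ?(gt_eqF kq) ?implybT//.
    by rewrite (_ : _ + _ = 0) ?powRr0//; ring.
  rewrite -[LHS]mul1r -[X in X * _ = _]e1; ring.
have E3 x : (\int[mu]_q V (x, q) <=
    c%:E * ((e x)%:E * mu [set q : T | (0 < q)%R /\ M (parabolic (x, q))]))%E.
  pose B := [set q : T | 0 < q /\ M (parabolic (x, q))].
  have mB : measurable B.
    rewrite (_ : B = xsection (pos `&` (parabolic @^-1` M)) x); last first.
      by apply/seteqP; split => q; rewrite /xsection/= inE.
    apply: measurable_xsection; apply: measurableI => //; apply: m_preimage => //.
    rewrite (_ : parabolic = fun p => parabolic (p.1, p.2)); first exact: m_parabolic.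
    by apply/funext => -[].
  rewrite muleCA; apply: le_trans (lee_wpmul2l _ (expandH mB)); last by rewrite lee_fin.
  have mwB : measurable_fun [set: T] (fun q => (w q * \1_B (H q))%:E).
    apply/measurable_EFinP/measurable_funM => //.
    by apply: measurableT_comp => //; exact: measurable_indic.
  rewrite -ge0_integralZl//; last 3 first.
  - exact: measurable_funS mwB.
  - by move=> q _; rewrite lee_fin mulr_ge0 ?powR_ge0.
  - by rewrite lee_fin.
  rewrite [leRHS]integral_mkcond; apply: ge0_le_integral_lower => [q _|q _]; first exact: V0.
  rewrite patchE; have [q0|q0] := ltP 0 q; last first.
    rewrite /V indicE memNset ?mulr0; last by move=> []; rewrite /pos/= ltNge q0.
    by case: ifPn => // _; rewrite -EFinM lee_fin mulr_ge0// mulr_ge0// powR_ge0.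
  rewrite mem_set; last by rewrite /= in_itv/= andbT.
  rewrite -EFinM /V /= -/(w q) mulrCA lee_fin le_eqVlt.
  apply/orP; left; apply/eqP; congr (_ * (_ * _)).
  by apply: indic_iff; split=> -[_ Mq]; split => //; exact: H_gt0.
rewrite E1 fubini_tonelli//.
have -> : (\int[mu]_q \int[mu]_x W (x, q) = \int[mu]_q \int[mu]_x V (x, q))%E.
  by apply: eq_integral => q _; exact: E2.
rewrite -fubini_tonelli//.
have mIM : measurable_fun [set: T] (fun x =>
    (e x)%:E * mu [set q : T | (0 < q)%R /\ M (parabolic (x, q))])%E.
  have mPM : measurable (pos `&` (parabolic @^-1` M)).
    apply: measurableI => //; apply: m_preimage => //.
    rewrite (_ : parabolic = fun p => parabolic (p.1, p.2)); first exact: m_parabolic.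
    by apply/funext => -[].
  apply: emeasurable_funM; first exact/measurable_EFinP.
  rewrite (_ : (fun x => _) = mu \o xsection (pos `&` (parabolic @^-1` M))).
    exact: measurable_fun_xsection.
  apply/funext => x /=; congr (mu _).
  by apply/seteqP; split => q; rewrite /xsection/= inE.
have IM0 x : (0 <= (e x)%:E * mu [set q : T | (0 < q)%R /\ M (parabolic (x, q))])%E.
  by rewrite mule_ge0// lee_fin.
have <- := ge0_integralZl mu measurableT mIM (fun x _ => IM0 x) (_ : (0 <= c%:E)%E).
  apply: ge0_le_integral_lower => x _; first by apply: integral_ge0.
  exact: E3.
by rewrite lee_fin.
Qed.

End plane_contraction.

(** * Balls *)

Section ball_upper.
Variables (R : realType) (al : R).
Hypothesis al1 : 1 <= al.
Local Notation mu := (@lebesgue_measure R).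
Implicit Types (gamma : R -> R * R) (T t s r : R).

Lemma horizontal_restrict T s gamma : s <= T ->
  horizontal al T gamma -> horizontal al s gamma.
Proof.
move=> sT [lip [a [b [[ma ia] [mb ib] d]]]].
have sub : `[0, s] `<=` `[0, T].
  by move=> t /=; rewrite !in_itv/= => /andP[-> /le_trans]; apply.
have mD : measurable (`[0, T]%classic : set R) by exact: measurable_itv.
have ms : measurable (`[0, s]%classic : set R) by exact: measurable_itv.
split.
  have [M [Mr ML]] := lip; exists M; split => // x Mx [u v] [/sub us /sub vs].
  exact: (ML x Mx (u, v)).
exists a, b; split.
- by split; [exact: measurable_funS ma|exact: integrableS ia].
- by split; [exact: measurable_funS mb|exact: integrableS ib].
- by apply: filterS d => t h ts; apply: h; exact: sub.
Qed.

Lemma length_restrict T s gamma : s <= T ->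
  (grushin_length al s gamma <= grushin_length al T gamma)%E.
Proof.
move=> sT; rewrite /grushin_length [leLHS]integral_mkcond [leRHS]integral_mkcond.
apply: ge0_le_integral_lower => t _; rewrite !patchE.
  by case: ifPn => // _; exact: speed_ge0.
case: ifPn => [|_]; last by case: ifPn => // _; exact: speed_ge0.
rewrite inE /= in_itv/= => /andP[t0 ts].
by rewrite mem_set// /= in_itv/= t0 (le_trans ts).
Qed.

Lemma norm_le_sqrt (a b : R) : `|a| <= Num.sqrt (a ^+ 2 + b ^+ 2).
Proof. by rewrite -sqrtr_sqr ler_wsqrtr// lerDl sqr_ge0. Qed.

Lemma horizontal_calibration_norm T gamma (g : R -> R) (L : R) :
  0 < T -> horizontal al T gamma -> 0 <= L ->
  (forall x y, 0 <= x <= T -> 0 <= y <= T -> `|g x - g y| <= L * `|x - y|) ->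
  (forall t a b, 0 < t < T -> is_derive t 1 (fun s => (gamma s).1) a ->
     is_derive t 1 (fun s => (gamma s).2) (b * `|(gamma t).1| `^ al) ->
     exists2 d, is_derive t 1 g d & `|d| <= Num.sqrt (a ^+ 2 + b ^+ 2)) ->
  (`|g T - g 0|%:E <= grushin_length al T gamma)%E.
Proof.
move=> T0 hg L0 gL cal.
have h1 : ((g T - g 0)%:E <= grushin_length al T gamma)%E.
  apply: (horizontal_calibration T0 hg L0 gL) => t a b tT dx dy.
  have [d gd dle] := cal _ _ _ tT dx dy; exists d => //.
  exact: le_trans (ler_norm _) dle.
have h2 : ((- g T - - g 0)%:E <= grushin_length al T gamma)%E.
  apply: (@horizontal_calibration _ _ T gamma (fun t => - g t) L T0 hg L0).
    by move=> x y xT yT; rewrite -opprD normrN; exact: gL.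
  move=> t a b tT dx dy.
  have [d gd dle] := cal _ _ _ tT dx dy; exists (- d); first exact: is_deriveN.
  by apply: le_trans dle; rewrite -normrN; exact: ler_norm.
have [h|h] := lerP 0 (g T - g 0); first by rewrite ger0_norm.
by rewrite ltr0_norm// opprB addrC; move: h2; rewrite opprK.
Qed.

Lemma horizontal_x_bound T gamma t : 0 < T -> horizontal al T gamma -> 0 <= t <= T ->
  (`|(gamma t).1 - (gamma 0).1|%:E <= grushin_length al T gamma)%E.
Proof.
move=> T0 hg /andP[]; rewrite le_eqVlt => /predU1P[<- _|t0 tT].
  rewrite subrr normr0; apply: integral_ge0 => s _; exact: speed_ge0.
apply: le_trans (length_restrict _ tT); have {}hg := horizontal_restrict tT hg.
have [L L0 gL] := horizontal_lipschitz hg.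
apply: (@horizontal_calibration_norm t gamma (fun s => (gamma s).1) L t0 hg L0).
  move=> x y xt yt; have := gL _ _ xt yt.
  by rewrite [X in X <= _ -> _]prod_normE ge_max => /andP[].
by move=> s a b _ dx _; exists a => //; exact: norm_le_sqrt.
Qed.

(** While |x| <= K, the function y / K^al has derivative at most |b| in absolute value, so it
    calibrates. *)
Lemma horizontal_y_bound T gamma K : 0 < T -> horizontal al T gamma -> 0 < K ->
  (forall t, 0 <= t <= T -> `|(gamma t).1| <= K) ->
  (`|((gamma T).2 - (gamma 0).2) / K `^ al|%:E <= grushin_length al T gamma)%E.
Proof.
move=> T0 hg K0 xK; have Ka : 0 < K `^ al by rewrite powR_gt0.
have [L L0 gL] := horizontal_lipschitz hg.
rewrite mulrBl.
apply: (@horizontal_calibration_norm T gamma (fun s => (gamma s).2 / K `^ al)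
  (L / K `^ al) T0 hg); first by rewrite divr_ge0// ltW.
  move=> x y xt yt; have := gL _ _ xt yt.
  rewrite [X in X <= _ -> _]prod_normE ge_max => /andP[_ l2].
  rewrite -mulrBl normrM normfV (gtr0_norm Ka) mulrAC; apply: ler_wpM2r => //.
  by rewrite invr_ge0 ltW.
move=> s a b /andP[s0 sT] _ dy; exists (b * `|(gamma s).1| `^ al / K `^ al).
  have := is_derive_cmul (K `^ al)^-1 dy.
  rewrite (_ : (fun y => _) = fun s => (gamma s).2 / K `^ al); last first.
    by apply/funext => z; rewrite mulrC.
  by move/is_derive_eq; apply; rewrite mulrC.
rewrite -mulrA normrM; apply: le_trans (_ : `|b| <= _); last first.
  by rewrite addrC; exact: norm_le_sqrt.
rewrite ler_piMr// ger0_norm ?divr_ge0 ?powR_ge0// ler_pdivrMr// mul1r.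
have al1' := al1; apply: ge0_ler_powR; rewrite ?nnegrE ?(ltW K0)//; first lra.
by apply: xK; rewrite !ltW.
Qed.

(** The bound on x comes first: it supplies the constant K = |q.1| + r for the bound on y. *)
Lemma ball_bounded (q : R * R) r : 0 < r ->
  grushin_ball al q r `<=` `[q.1 - r, q.1 + r] `*`
    `[q.2 - r * (`|q.1| + r) `^ al, q.2 + r * (`|q.1| + r) `^ al].
Proof.
move=> r0 p /ereal_inf_lt[_ [T [gamma [T0 hg g0 gT ->]]] len].
have xb t : 0 <= t <= T -> `|(gamma t).1 - q.1| < r.
  move=> tT; have := horizontal_x_bound T0 hg tT; rewrite g0 => h.
  by have := le_lt_trans h len; rewrite lte_fin.
have K0 : 0 < `|q.1| + r by rewrite ltr_wpDl.
have xK t : 0 <= t <= T -> `|(gamma t).1| <= `|q.1| + r.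
  move=> /xb/ltW h; rewrite -(subrK q.1 (gamma t).1) addrC.
  by apply: le_trans (ler_normD _ _) _; rewrite lerD2l.
have Ka : 0 < (`|q.1| + r) `^ al by rewrite powR_gt0.
have := le_lt_trans (horizontal_y_bound T0 hg K0 xK) len.
rewrite lte_fin g0 gT normrM normfV (gtr0_norm Ka) ltr_pdivrMr// => /ltW.
have := ltW (xb T _); rewrite gT lexx (ltW T0) => /(_ isT).
rewrite !ler_distl => h1 h2; split; rewrite /= in_itv/= //.
Qed.

End ball_upper.

Section ball_lower.
Variables (R : realType) (al : R).
Hypothesis al1 : 1 <= al.
Implicit Types (t r : R).

(** The integral of (|x1| + s d)^al over s in [0, t]: the height gained with unit control on Y while
    |x| grows from |x1| at rate d. *)
Definition segment_area (x1 d t : R) :=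
  ((`|x1| + t * d) `^ (al + 1) - `|x1| `^ (al + 1)) / ((al + 1) * d).

Lemma is_derive_segment_area x1 d t : 0 < d -> 0 < t ->
  is_derive t 1 (segment_area x1 d) ((`|x1| + t * d) `^ al).
Proof.
move=> d0 t0; have al1' := al1.
have a0 : al + 1 != 0 by rewrite gt_eqF//; lra.
have d1 : is_derive t 1 (fun z => `|x1| + d * z) (0 + d * 1).
  exact: (is_derive_add (is_derive_cst _ t 1) (is_derive_cmul d (is_derive_id t 1))).
have h0 : 0 < `|x1| + d * t by rewrite ltr_wpDl// mulr_gt0.
have d2 := is_derive_sub (is_derive_powR (f := fun z => `|x1| + d * z) (al + 1) h0 d1)
  (is_derive_cst (`|x1| `^ (al + 1)) t 1).
have := is_derive_cmul ((al + 1) * d)^-1 d2.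
rewrite (_ : (fun y => _) = segment_area x1 d); last first.
  by apply/funext => z; rewrite /segment_area mulrC (mulrC d).
move/is_derive_eq; apply; rewrite addrK (mulrC d t); field.
by rewrite a0 (gt_eqF d0).
Qed.

(** Constant controls (sg d, c) move x away from the singular axis, so |x| = |x1| + t d and the
    height is explicit; the speed is at most d + |c|. *)
Lemma dist_short_curve (x1 y1 sg d c : R) : 0 < d -> `|sg| = 1 -> sg * `|x1| = x1 ->
  (grushin_dist al (x1, y1) (x1 + sg * d, y1 + c * segment_area x1 d 1)%R <= (d + `|c|)%:E)%E.
Proof.
move=> d0 sg1 sgx; have al1' := al1.
pose x t : R := x1 + sg * d * t.
pose y t : R := y1 + c * segment_area x1 d t.
have xE t : 0 <= t -> `|x t| = `|x1| + t * d.
  move=> t0; rewrite /x -{1}sgx -mulrA -mulrDr normrM sg1 mul1r ger0_norm.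
    by rewrite mulrC.
  by rewrite addr_ge0// mulr_ge0// ltW.
have cA : {within `[0, 1], continuous (segment_area x1 d)}.
  have cp : continuous (fun z : R => `|z| `^ (al + 1)).
    by apply: continuous_norm_powR; lra.
  have cl : continuous (fun t => `|x1| + t * d).
    move=> t; apply: cvgD; first exact: cvg_cst.
    by apply: cvgM; [exact: cvg_id|exact: cvg_cst].
  have cc : continuous (fun t => (`| `|x1| + t * d| `^ (al + 1) - `|x1| `^ (al + 1)) / ((al + 1) * d)).
    move=> t; apply: cvgM; last exact: cvg_cst.
    apply: cvgB; last exact: cvg_cst.
    apply: (@continuous_comp _ _ _ (fun t => `|x1| + t * d) (fun z : R => `|z| `^ (al + 1))).
      exact: cl.
    exact: cp.
  apply: subspace_eq_continuous (continuous_subspaceT cc) => t.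
  rewrite inE/= in_itv/= => /andP[t0 _].
  have h : 0 <= `|x1| + t * d by rewrite addr_ge0// mulr_ge0// ltW.
  by rewrite /segment_area /from_subspace /= (ger0_norm h).
have ccst (a : R) : {within `[0, 1], continuous (fun _ : R => a)}.
  by apply: (@continuous_subspaceT _ _ _ (fun _ : R => a)) => z; exact: cvg_cst.
have cx : {within `[0, 1], continuous x}.
  apply: continuous_subspaceT => t; apply: cvgD; first exact: cvg_cst.
  by apply: cvgM; [exact: cvg_cst|exact: cvg_id].
have cy : {within `[0, 1], continuous y}.
  move=> t; apply: cvgD; first exact: cvg_cst.
  by apply: cvgM; [exact: cvg_cst|exact: cA].
have dx t : 0 < t < 1 -> is_derive t 1 x (cst (sg * d) t).
  move=> _; have := is_derive_add (is_derive_cst x1 t 1)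
    (is_derive_cmul (sg * d) (is_derive_id t 1)).
  by move/is_derive_eq; apply; rewrite add0r mulr1.
have dy t : 0 < t < 1 -> is_derive t 1 y (cst c t * `|x t| `^ al).
  move=> /andP[t0 _]; have := is_derive_add (is_derive_cst y1 t 1) (is_derive_cmul c (is_derive_segment_area x1 d0 t0)).
  by move/is_derive_eq; apply; rewrite add0r xE// ltW.
have hor := curve_horizontal al1 cx cy (ccst _) (ccst _) dx dy.
have len : (grushin_length al 1 (fun t => (x t, y t)) <= (d + `|c|)%:E)%E.
  apply: (curve_length_le dx dy) => t _.
  have dc : 0 <= d + `|c| by rewrite addr_ge0// ltW.
  rewrite -(ger0_norm dc) -sqrtr_sqr ler_wsqrtr// /cst exprMn -[sg ^+ 2]real_normK ?num_real//.
  rewrite sg1 expr1n mul1r -[c ^+ 2]real_normK ?num_real// sqrrD.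
  by have := mulr_ge0 (ltW d0) (normr_ge0 c); lra.
apply: le_trans len; apply: ereal_inf_lbound.
exists 1, (fun t => (x t, y t)); split => //; last by rewrite /x mulr1.
rewrite /x /y mulr0 addr0; congr (_, _).
by rewrite /segment_area mul0r addr0 subrr mul0r mulr0 addr0.
Qed.

End ball_lower.

Section ball_measure.
Variables (R : realType) (al : R).
Hypothesis al1 : 1 <= al.
Implicit Types (t r d : R) (q : R * R).
Local Notation mu := (@lebesgue_measure R).
Local Notation T := (measurableTypeR R).

(** From (|x| + d)^(al+1) - |x|^(al+1) >= d (|x| + d)^al >= d^(al+1); the bound is uniform in x, so
    it also serves on the singular axis. *)
Lemma segment_area_ge (x d : R) : 0 < d ->
  d `^ al / (al + 1) <= segment_area al x d 1.
Proof.
move=> d0; have al1' := al1; rewrite /segment_area mul1r.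
have a0 : 0 < al + 1 by lra.
have p1 y : 0 <= y -> y `^ (al + 1) = y * y `^ al.
  move=> y0; rewrite addrC powRD ?powRr1//.
  by rewrite (_ : 1 + al == 0 = false)// gt_eqF// addrC.
have x0 := normr_ge0 x.
have xd : 0 <= `|x| + d by rewrite addr_ge0// ltW.
rewrite ler_pdivlMr ?mulr_gt0// mulrA divfK ?gt_eqF// mulrC !p1//.
have h1 : `|x| `^ al <= (`|x| + d) `^ al.
  by apply: ge0_ler_powR; rewrite ?nnegrE//; lra.
have h2 : d `^ al <= (`|x| + d) `^ al.
  by apply: ge0_ler_powR; rewrite ?nnegrE//; lra.
have := ler_wpM2l x0 h1; have := ler_wpM2l (ltW d0) h2.
by rewrite mulrDl; lra.
Qed.

Lemma ball_contains q r : 0 < r -> exists x e h : R, [/\ 0 < e, 0 < h &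
  `[x - e, x + e] `*` `[q.2 - h, q.2 + h] `<=` grushin_ball al q r].
Proof.
case: q => x1 y1 r0 /=; have al1' := al1.
have [sg [sg1 sg2 sgx]] : exists sg : R, [/\ `|sg| = 1, sg * sg = 1 & sg * `|x1| = x1].
  have [x0|x0] := leP 0 x1.
    by exists 1; rewrite normr1 !mul1r ger0_norm.
  by exists (-1); rewrite normrN normr1 mulrNN mulr1 ltr0_norm// mulrNN mul1r.
pose A := (r / 4) `^ al / (al + 1).
have A0 : 0 < A by rewrite divr_gt0 ?powR_gt0 ?divr_gt0//; lra.
(* The box is shifted sideways because height is gained only away from the axis. Its width gives r/4
   <= d <= r/3, so the gain per unit of c is at least A, |c| <= r/3, and the total cost is at most 2
   r / 3. *)
exists (x1 + sg * (7 / 24 * r)), (r / 24), (A * (r / 3)).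
split; [by rewrite divr_gt0|by rewrite mulr_gt0// divr_gt0|].
case=> x y []; rewrite /= !in_itv/= -!ler_distl => hx hy.
pose d := sg * (x - x1).
have dE : x = x1 + sg * d by rewrite /d mulrA sg2 mul1r addrC subrK.
have /ler_normlP[hd1 hd2] : `|d - 7 / 24 * r| <= r / 24.
  by move: hx; rewrite dE opprD addrACA subrr add0r -mulrBr normrM sg1 mul1r.
have d0 : 0 < d by lra.
have Ad : A <= segment_area al x1 d 1.
  apply: le_trans (segment_area_ge x1 d0); apply: ler_wpM2r.
    by rewrite invr_ge0; lra.
  by apply: ge0_ler_powR; rewrite ?nnegrE; lra.
have sA : 0 < segment_area al x1 d 1 by exact: lt_le_trans A0 Ad.
pose c := (y - y1) / segment_area al x1 d 1.
have cE : y = y1 + c * segment_area al x1 d 1.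
  by rewrite /c divfK ?gt_eqF// addrC subrK.
have cr : `|c| <= r / 3.
  rewrite /c normrM normfV (gtr0_norm sA) ler_pdivrMr// mulrC.
  by apply: le_trans hy _; apply: ler_wpM2r => //; rewrite ltW// divr_gt0.
rewrite /grushin_ball /= dE cE.
apply: le_lt_trans (dist_short_curve al1 y1 c d0 sg1 sgx) _.
by rewrite lte_fin; lra.
Qed.

Lemma le_leb2 (A B : set (R * R)) : A `<=` B -> (leb2 A <= leb2 B)%E.
Proof. exact: le_mu_ext. Qed.

Lemma leb2_rectangle (a b a' b' : R) : a < b -> a' < b' ->
  leb2 (`[a, b] `*` `[a', b']) = ((b - a) * (b' - a'))%:E.
Proof.
move=> ab ab'.
have m1 : measurable (`[a, b]%classic : set T) by exact: measurable_itv.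
have m2 : measurable (`[a', b']%classic : set T) by exact: measurable_itv.
rewrite /leb2 measurable_mu_extE; last exact: measurableX.
rewrite [LHS](@product_measure1E _ _ T T R mu mu _ _ m1 m2).
have len (u v : R) : u < v -> mu `[u, v] = (v - u)%:E.
  by move=> uv; rewrite lebesgue_measure_itv/= lte_fin uv -EFinB.
by rewrite EFinM; congr (_ * _)%E; exact: len.
Qed.

Lemma ball_measure_gt0 q r : 0 < r -> (0 < leb2 (grushin_ball al q r))%E.
Proof.
move=> r0; have [x [e [h [e0 h0 sub]]]] := ball_contains q r0.
apply: lt_le_trans (le_leb2 sub); rewrite leb2_rectangle; [|lra|lra].
by rewrite lte_fin mulr_gt0//; lra.
Qed.

Lemma ball_measure_fin q r : 0 < r -> (leb2 (grushin_ball al q r) < +oo)%E.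
Proof.
move=> r0; apply: le_lt_trans (le_leb2 (ball_bounded al1 r0)) _.
have h0 : 0 < r * (`|q.1| + r) `^ al by rewrite mulr_gt0// powR_gt0// ltr_wpDl.
by rewrite leb2_rectangle ?ltry//; [lra|lra].
Qed.

End ball_measure.

(** * The distortion coefficient *)

Section intermediate_measure.
Variables (R : realType) (al P : R) (S C Y phi : R -> R).
Hypothesis al1 : 1 <= al.
Hypothesis G : gentrig al P S C Y.
Hypothesis phiP : forall q : R, 0 < q -> [/\ 0 < phi q < P, ratio al S Y (phi q) = q &
  is_derive q 1 phi (S (phi q) `^ (al + 2) / gsym S C (phi q))].
Variable t : R.
Hypothesis t01 : 0 < t <= 1.
Implicit Types (q x y s : R).
Local Notation mu := (@lebesgue_measure R).
Local Notation T := (measurableTypeR R).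
Local Notation mu2 := (mu \x mu)%E.

Let D : set T := `]0, +oo[%classic.

Let DP q : D q <-> 0 < q. Proof. by rewrite /D /= in_itv/= andbT. Qed.

Let mD : measurable D. Proof. exact: measurable_itv. Qed.

Let patchD (f : T -> T) q : 0 < q -> (f \_ D) q = f q.
Proof. by move=> /DP/mem_set Dq; rewrite patchT. Qed.

Let m_patch (f : R -> R) : (forall q, 0 < q -> {for q, continuous f}) ->
  measurable_fun [set: T] ((f : T -> T) \_ D).
Proof.
move=> cf; apply/(measurable_restrictT _ mD).
apply: open_continuous_measurable_fun; first exact: interval_open.
by move=> q; rewrite inE => /DP/cf.
Qed.

(** [\_ D] extends by 0 off ]0, +oo[, which yields a measurable function on the whole line. *)
Let k : T -> T := (shrink S phi t : T -> T) \_ D.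
Let H : T -> T := (slide al S Y phi t : T -> T) \_ D.
Let c := t `^ (- (2 * al + 2)).

Let c_gt0 : 0 < c. Proof. by have /andP[t0 _] := t01; rewrite powR_gt0. Qed.

Let k_gt0 q : 0 < q -> 0 < k q.
Proof. by move=> q0; rewrite /k patchD// (shrink_gt0 G phiP t01 q0). Qed.

Let H_gt0 q : 0 < q -> 0 < H q.
Proof. by move=> q0; rewrite /H patchD// (slide_gt0 al1 G phiP t01 q0). Qed.

Let mk : measurable_fun setT k.
Proof.
apply: (m_patch (f := shrink S phi t)) => q q0.
exact: (continuous_shrink G phiP t01 q0).
Qed.

Let mH : measurable_fun setT H.
Proof.
apply: (m_patch (f := slide al S Y phi t)) => q q0.
exact: is_derive_continuous (is_derive_slide al1 G phiP t01 q0).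
Qed.

Let w q := (shrink S phi t q)^-1 `^ (al + 2).

Let w_gt0 q : 0 < q -> 0 < w q.
Proof. by move=> q0; rewrite powR_gt0// invr_gt0 (shrink_gt0 G phiP t01 q0). Qed.

Let wc q : 0 < q -> {for q, continuous w}.
Proof.
move=> q0; have k0 := shrink_gt0 G phiP t01 q0.
apply: (@continuous_comp _ _ _ (fun q => (shrink S phi t q)^-1) (fun z => z `^ (al + 2))).
  by apply: cvgV; [rewrite gt_eqF|exact: (continuous_shrink G phiP t01 q0)].
by apply: continuous_powR; rewrite invr_gt0.
Qed.

Let expandH (B : set T) : measurable B ->
  (\int[mu]_(q in `]0%R, +oo[) (k q `^ (- (al + 2)) * \1_B (H q))%:E <= c%:E * mu B)%E.
Proof.
move=> mB; have := @expand_measurable _ (slide al S Y phi t)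
  (dslide al S C phi t) w c c_gt0 (is_derive_slide al1 G phiP t01) _ wc w_gt0 _ B mB.
rewrite (_ : integral _ _ _ = \int[mu]_(q in D) (k q `^ (- (al + 2)) * \1_B (H q))%:E)%E.
  apply.
    by move=> q q0; exact: (continuous_dslide al1 G phiP t01 q0).
  by move=> q q0; exact: (dslide_ge al1 G phiP t01 q0).
apply: eq_integral => q; rewrite inE => /DP q0; congr (_ * _)%:E.
  by rewrite /k patchD// /w -[_^-1]powR_inv1 ?ltW// ?(shrink_gt0 G phiP t01 q0)// -powRrM mulN1r.
by rewrite /H patchD.
Qed.

Let leb2E (A : set (T * T)) : measurable A -> leb2 A = mu2 A.
Proof. exact: measurable_mu_extE. Qed.

Let vertical : set (T * T) := [set 0] `*` setT.
Let horizontal_line (y0 : R) : set (T * T) := setT `*` [set y0].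

Let mvertical : measurable vertical.
Proof. by apply: measurableX => //; exact: measurable_set1. Qed.

Let mhorizontal y0 : measurable (horizontal_line y0).
Proof. by apply: measurableX => //; exact: measurable_set1. Qed.

Let vertical0 : mu2 vertical = 0%E.
Proof.
transitivity (mu [set 0%R] * mu setT)%E; first exact: product_measure1E.
by rewrite lebesgue_measure_set1 mul0e.
Qed.

Let horizontal0 y0 : mu2 (horizontal_line y0) = 0%E.
Proof.
transitivity (mu setT * mu [set y0])%E; first exact: product_measure1E.
by rewrite lebesgue_measure_set1 mule0.
Qed.

(** The set B is arbitrary: measurability is carried by a cover [M] of the intermediate set and by
    its preimages under the contraction. *)
Lemma intermediate_measure_ge (y0 : R) (B : set (R * R)) :
  (leb2 B <= c%:E * leb2 (intermediate al t (0%R, y0) B))%E.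
Proof.
pose con s := contraction al k H y0 s; pose half s := half_plane y0 s.
rewrite -lee_pdivrMl//; apply: le_ereal_inf_tmp => _ [F [mF ZF] <-].
rewrite lee_pdivrMl//; set M := \bigcup_k F k in ZF.
have mM : measurable (M : set (T * T)) by exact: bigcup_measurable.
have mh s : measurable (half s) by exact: measurable_half_plane.
have s2 : (1 : R) * 1 = 1 by rewrite mulr1.
have s2' : (-1 : R) * -1 = 1 by rewrite mulrNN mulr1.
have mC s : measurable ((con s @^-1` M) `&` half s).
  apply: measurableI => //; rewrite -[X in measurable X]setTI.
  exact: (measurable_contraction al1 y0 s mk mH).
(* Off the two null lines a point of B is the end of an explicit minimiser, whose point at time t
   lies in [M] and is the image of the end point under the contraction. *)
have sub : B `<=` vertical `|` horizontal_line y0 `|`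
    ((con 1 @^-1` M) `&` half 1) `|` ((con (-1) @^-1` M) `&` half (-1)).
  case=> x y Bxy; have [->|x0] := eqVneq x 0; first by left; left; left; split.
  have [->|y0'] := eqVneq y y0; first by left; left; right; split.
  have [gamma [geo mini g0 g1 gt]] := minimising_geodesic_to al1 G phiP x0 y0'.
  have q0 : 0 < `|y - y0| / `|x| `^ (al + 1).
    by rewrite divr_gt0 ?normr_gt0 ?subr_eq0// powR_gt0// normr_gt0.
  have key s : s = Num.sg (y - y0) -> ((con s @^-1` M) `&` half s) (x, y).
    move=> sE; have sy : s * (y - y0) = `|y - y0| by rewrite sE -normrEsg.
    split; last by split => //=; rewrite sy normr_gt0 subr_eq0.
    have [z Fz Mz] : M (gamma t) by apply: ZF; exists gamma; split => //; rewrite g1.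
    exists z => //; move: Mz; rewrite gt// -sE /con /contraction /parabolic /= sy.
    by rewrite /k /H !patchD.
  have [yy|yy] := ltP y0 y.
    by left; right; apply: key; rewrite gtr0_sg// subr_gt0.
  by right; apply: key; rewrite ltr0_sg// subr_lt0 lt_neqAle y0'.
apply: le_trans (le_leb2 sub) _.
have mVH : measurable (vertical `|` horizontal_line y0) by exact: measurableU.
have mVH1 : measurable (vertical `|` horizontal_line y0 `|` ((con 1 @^-1` M) `&` half 1)).
  by apply: measurableU.
have cm s : s * s = 1 ->
    (mu2 ((con s @^-1` M) `&` half s) <= c%:E * mu2 (M `&` half s))%E.
  move=> ss; apply: (contraction_measure al1 y0 _ ss mk mH) => //.
  exact: ltW.
rewrite leb2E; last exact: measurableU.
apply: le_trans (measureU2 _ mVH1 (mC _)) _.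
have cm1 : (mu2 (vertical `|` horizontal_line y0 `|` ((con 1%R @^-1` M) `&` half 1%R)) <=
    c%:E * mu2 (M `&` half 1%R))%E.
  apply: le_trans (measureU2 _ mVH (mC _)) _.
  rewrite -[leRHS]add0e; apply: leeD; last exact: cm.
  apply: le_trans (measureU2 _ mvertical (mhorizontal _)) _.
  by rewrite [X in (X + _)%E]vertical0 [X in (_ + X)%E]horizontal0 adde0.
apply: le_trans (leeD cm1 (cm _ s2')) _.
rewrite -ge0_muleDr ?measure_ge0//; apply: lee_wpmul2l; first by rewrite lee_fin ltW.
(* Each half-plane is compared with the part of [M] inside it, and the two are disjoint, so no
   factor 2 is lost. *)
rewrite -measureU; [|exact: measurableI|exact: measurableI|]; last first.
  apply/seteqP; split => // -[x y] [[_ [_ h1]] [_ [_ h2]]].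
  by move: h1 h2 => /=; rewrite mul1r mulN1r; lra.
apply: (@le_trans _ _ (mu2 M)).
  apply: le_measure; rewrite ?inE//; first by apply: measurableU; exact: measurableI.
  by move=> p [[]|[]].
exact: measure_sigma_subadditive.
Qed.

End intermediate_measure.

Lemma intermediate_ratio_ge (R : realType) (al t : R) (q0 : R * R) (B : set (R * R)) :
  1 <= al -> 0 < t <= 1 -> q0.1 = 0 -> (0 < leb2 B)%E -> (leb2 B < +oo)%E ->
  ((t `^ (2 * al + 2))%:E <= leb2 (intermediate al t q0 B) / leb2 B)%E.
Proof.
case: q0 => x0 y0 al1 t01 /= -> B0 Boo; have /andP[t0 _] := t01.
have [P [S [C [Y G]]]] := gentrig_exists al1.
have [phi phiP] := profile_exists al1 G.
have := intermediate_measure_ge al1 G phiP t01 y0 B.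
have bE : leb2 B = (fine (leb2 B))%:E by rewrite fineK// ge0_fin_numE// ltW.
rewrite bE; move: B0; rewrite {1}bE lte_fin => b0.
have T0 : 0 < t `^ (2 * al + 2) by rewrite powR_gt0.
rewrite powRN inver gt_eqF// => h; rewrite lee_pdivlMr//.
by move: h; rewrite -lee_pdivrMl ?invr_gt0// invrK.
Qed.

Theorem proposition27 (R : realType) (alpha : R) (halpha : 1 <= alpha) :
  exists m : R, is_m_alpha alpha m /\
    forall q0 q : R * R, q0.1 = 0 -> ~ Cut alpha q0 q ->
    forall t N : R, 0 <= t <= 1 ->
      2 * (((alpha + 1) * m + 1) / (m + 1)) <= N ->
      ((t `^ N)%:E <= distortion alpha t q0 q)%E.
Proof.
have [m mP mN] := is_m_alpha_exists halpha.
exists m; split => // q0 q q00 _ t N /andP[t0 t1] /(le_trans mN) NN.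
rewrite /distortion limf_esupE; apply: le_ereal_inf_tmp => _ [V FV <-].
(* The bound on the quotient holds at every positive radius, and each set of the filter contains
   one, so every supremum in the upper limit is large enough. *)
have [r [Vr r0]] : exists r, V r /\ 0 < r.
  by have [r []] := filter_ex (filterI FV (nbhs_right_gt 0)); exists r.
apply: ereal_sup_ge; exists (leb2 (intermediate alpha t q0 (grushin_ball alpha q r)) /
  leb2 (grushin_ball alpha q r))%E; first by exists r.
have B0 := ball_measure_gt0 halpha q r0.
have Boo := ball_measure_fin halpha q r0.
move: t0; rewrite le_eqVlt => /predU1P[<-|t0].
  (* At t = 0 the power is 0 because N >= 2 alpha + 2 is non-zero. *)
  rewrite powR0; last by rewrite gt_eqF//; lra.
  apply: mule_ge0; first exact: mu_ext_ge0.
  by rewrite inve_ge0 ltW.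
have t01 : 0 < t <= 1 by rewrite t0.
apply: le_trans (intermediate_ratio_ge halpha t01 q00 B0 Boo).
by rewrite lee_fin ger_powR.
Qed.
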